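(* Let $\Omega=(a,b)\subset\mathbb{R}$ be a bounded open interval, $f\in BV(\Omega)$, and let $\alpha\in C(\overline\Omega)$ with $\alpha>0$ on $\overline\Omega$ be differentiable in an open interval $I\subseteq\Omega$ and such that $$|\alpha'(x)|>2\|f\|_{\infty}\quad\text{for all }x\in I,$$ where $\|f\|_\infty$ is the $L^\infty(\Omega)$ norm. Let $u$ be the solution of $$\min_{u\in BV(\Omega)}\ \frac12\int_\Omega (f-u)^2\,dx+\int_\Omega \alpha(x)\,d|Du| .$$ Then $u$ is constant in $I$.
   Context: For $u\in BV(\Omega)$, $Du$ denotes its distributional derivative (a finite Radon measure) and $|Du|$ its total variation measure; ''$u$ is constant in $I$'' means $|Du|(I)=0$. The minimisation problem has a unique solution. *)

(* Defs.v *)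
From HB Require Import structures.
From mathcomp Require Import all_boot all_order all_algebra.
From mathcomp Require Import all_classical all_reals all_analysis.
Set Implicit Arguments.
Unset Strict Implicit.
Unset Printing Implicit Defensive.
Import Order.TTheory GRing.Theory Num.Theory.
Import numFieldNormedType.Exports.
Local Open Scope classical_set_scope.
Local Open Scope ring_scope.

Section signed_measures.
Context d (T : measurableType d) (R : realType).
Variable nu : {charge set T -> \bar R}.

Lemma hahn_decomposition_ex :
  exists PN : set T * set T, hahn_decomposition nu PN.1 PN.2.
Proof. by have [P [N PN]] := Hahn_decomposition nu; exists (P, N). Qed.

(* The Jordan decomposition does not depend, on measurable sets, on the
   Hahn decomposition that is chosen here. *)
Definition hahnP : hahn_decomposition nu _ _ :=
  projT2 (cid hahn_decomposition_ex).

Definition total_variation_measure : {measure set T -> \bar R} :=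
  charge_variation hahnP.

Definition charge_integral (D : set T) (g : T -> \bar R) : \bar R :=
  (\int[jordan_pos hahnP]_(x in D) g x - \int[jordan_neg hahnP]_(x in D) g x)%E.

End signed_measures.

Section bounded_variation_functions.
Context (R : realType).
Variables a b : R.

Definition test_function (phi : R -> R) : Prop :=
  [/\ forall n x, derivable (derive1n n phi) x 1,
      compact (closure [set x | phi x != 0]) &
      closure [set x | phi x != 0] `<=` `]a, b[ ].

(* A finite Radon measure on ]a, b[ is a charge on the Borel sets of R that is
   carried by ]a, b[; charges are finite-valued, and finite Borel measures on
   an interval are automatically regular. *)
Definition is_distributional_derivative (u : R -> R)
    (mu : {charge set R -> \bar R}) : Prop :=
  (forall A, measurable A -> mu A = mu (A `&` `]a, b[)) /\
  (forall phi, test_function phi ->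
    \int[lebesgue_measure]_(x in `]a, b[) (u x * derive1 phi x)%:E =
    - charge_integral mu `]a, b[ (EFin \o phi))%E.

(* Functions are representatives R -> R of classes in L^1(]a, b[); only their
   values on ]a, b[ matter. *)
Definition BV (u : R -> R) : Prop :=
  lebesgue_measure.-integrable `]a, b[ (EFin \o u) /\
  exists mu, is_distributional_derivative u mu.

(* For u in BV the derivative is unique on Borel sets; the value czero for the
   other functions is never used. *)
Definition distributional_derivative (u : R -> R) : {charge set R -> \bar R} :=
  if pselect (exists mu, is_distributional_derivative u mu) is left exmu
  then projT1 (cid exmu) else czero.

Definition abs_derivative (u : R -> R) : {measure set R -> \bar R} :=
  total_variation_measure (distributional_derivative u).

Definition norm_Linfty (f : R -> R) : \bar R :=
  'N[mrestr lebesgue_measure (measurable_itv `]a, b[)]_+oo[EFin \o f]%E.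

Definition weighted_TV_energy (alpha f u : R -> R) : \bar R :=
  (2^-1%:E * \int[lebesgue_measure]_(x in `]a, b[) ((f x - u x) ^+ 2)%:E +
   \int[abs_derivative u]_(x in `]a, b[) (alpha x)%:E)%E.

Definition weighted_TV_solution (alpha f u : R -> R) : Prop :=
  BV u /\
  forall v, BV v ->
    (weighted_TV_energy alpha f u <= weighted_TV_energy alpha f v)%E.

Definition constant_in (u : R -> R) (I : set R) : Prop :=
  abs_derivative u I = 0%E.

End bounded_variation_functions.

(* Main.v *)
(** The optimality conditions of the problem are exploited through the function
    [G s], the integral of [f - u] over [(s, b)], and the good representative
    [v] of [u], [v x = C + Du (a, x]].  Perturbing [u] by constants, by Heaviside
    functions and by multiples of [u] gives [G a = G b = 0], [|G| <= alpha], and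
    [G = alpha] (resp. [G = - alpha]) almost everywhere for the positive (resp.
    negative) part of [Du].  Suppose [G s = alpha s > 0].  Starting from a point
    near [s], where [G] is positive, [v] is nondecreasing as long as [G] stays
    positive; since [G' = u - f], a value of [v] outside [[-M, M]], with [M]
    the sup norm of [f], would keep [G] positive up to an endpoint, which is
    absurd.  So [G] is [2 M]-Lipschitz near [s], while [alpha - G] has a minimum
    at [s], whence [|alpha' s| <= 2 M].  In [I] there is thus no contact between
    [G] and [alpha] or [- alpha], and [|Du| I = 0]. *)
Require Import Defs.
From HB Require Import structures.
From mathcomp Require Import all_boot all_order all_algebra.
From mathcomp Require Import all_classical all_reals all_analysis.
From mathcomp Require Import measurable_realfun ess_sup_inf ring lra.
Import Order.TTheory GRing.Theory Num.Theory.
Import numFieldNormedType.Exports.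
Local Open Scope classical_set_scope.
Local Open Scope ring_scope.
Set Implicit Arguments.
Unset Strict Implicit.
Unset Printing Implicit Defensive.

(** * Smooth bump functions *)

Section smooth_functions.
Context {R : realType}.
Implicit Types f g : R -> R.

(** The energy is built on a derivative and on a Hahn decomposition obtained by choice, so the
    weighted variation of a competitor cannot be computed directly. Minimality, however, asks only
    for the exact value at [u] and an upper bound at the competitor, and any two finite measures
    whose difference is the derivative give such a bound. The perturbations therefore act on pairs
    of measures: a jump adds a Dirac mass to one member of the pair, a contraction scales both. That
    [G = alpha] or [G = - alpha] holds almost everywhere for the two parts of [Du] comes out of one
    inequality: contracting the good representative shows that the nonnegative functions [alpha - G]
    and [alpha + G], integrated against the positive and the negative part, have a sum at most [0].
    The threshold [2 M] bounds [G' = v - f] once [v] and [f] both lie in [[- M, M]]. No continuity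
    of [alpha'] is available, so [alpha'] at a contact point is compared with one-sided increments
    of [G]. Contact with [- alpha] is the same statement for [- G] and [- v]. *)

Fixpoint iter_derivable (n : nat) f : Prop :=
  if n is n'.+1 then
    (forall x, derivable f x 1) /\ iter_derivable n' (derive1 f)
  else True.

(** [derive1n] applies the last derivative outermost, whereas the closure proofs below peel off the
    first one; iterating on either side gives the same function. *)
Lemma iter_derivableP f :
  (forall n x, derivable (derive1n n f) x 1) <->
  (forall n, iter_derivable n f).
Proof.
have E n g : derive1n n (derive1 g) = derive1n n.+1 g.
  by rewrite /derive1n -iterSr.
split=> [df n|df n].
  elim: n f df => //= n IH f df; split; first exact: (df 0%N).
  by apply: IH => k x; rewrite E; exact: (df k.+1).
elim: n f df => [|n IH] f df; first exact: (df 1%N).1.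
by rewrite -E; apply: IH => k; have [] := df k.+1.
Qed.

Lemma iter_derivableW n f : iter_derivable n.+1 f -> iter_derivable n f.
Proof.
elim: n f => // n IH f [df d2f]; split=> //.
exact: IH.
Qed.

Lemma iter_derivable_ext n f (df : R -> R) :
  (forall x : R, is_derive x 1 f (df x)) -> iter_derivable n df ->
  iter_derivable n.+1 f.
Proof.
move=> fdf ndf; split=> [x|]; first by have [] := fdf x.
suff -> : derive1 f = df by [].
by apply/funext => x; rewrite derive1E; have [_ ->] := fdf x.
Qed.

Lemma is_derive1_derivable f (x : R) :
  derivable f x 1 -> is_derive x 1 f (derive1 f x).
Proof. by move=> df; rewrite derive1E; exact: derivableP. Qed.

Lemma iter_derivable_cst n (k : R) : iter_derivable n (fun=> k).
Proof.
elim: n k => // n IH k; apply: (@iter_derivable_ext n _ (fun=> 0)) => //.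
Qed.

Lemma iter_derivableD n f g :
  iter_derivable n f -> iter_derivable n g ->
  iter_derivable n (fun x => f x + g x).
Proof.
elim: n f g => // n IH f g [df nf] [dg ng].
apply: (@iter_derivable_ext n _ (fun x => derive1 f x + derive1 g x));
  last exact: IH.
by move=> x; apply: is_deriveD; exact: is_derive1_derivable.
Qed.

Lemma iter_derivableM n f g :
  iter_derivable n f -> iter_derivable n g ->
  iter_derivable n (fun x => f x * g x).
Proof.
elim: n f g => // n IH f g nf ng.
have [df n'f] := nf; have [dg n'g] := ng.
apply: (@iter_derivable_ext n _
  (fun x => f x * derive1 g x + g x * derive1 f x)).
  move=> x.
  have dfx := is_derive1_derivable (df x).
  have dgx := is_derive1_derivable (dg x).
  exact: is_deriveM.
by apply: iter_derivableD; apply: IH => //; exact: iter_derivableW.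
Qed.

Lemma iter_derivable_affine n f (r s : R) :
  iter_derivable n f -> iter_derivable n (fun x => f (r * x + s)).
Proof.
elim: n f => // n IH f [df nf].
apply: (@iter_derivable_ext n _
  (fun x => derive1 f (r * x + s) * r)); last first.
  apply: iter_derivableM; last exact: iter_derivable_cst.
  exact: IH.
move=> x.
have dl : is_derive x 1 (fun y : R => r * y + s) r.
  apply: is_derive_eq; by rewrite addr0 /GRing.scale/= mulr1.
have := is_derive1_derivable (df (r * x + s)) => dfx.
exact: (@is_derive1_comp _ f (fun y => r * y + s) x _ _ dfx dl).
Qed.

(** For [m = 0] this is the classical smooth function [exp (- 1 / x)] extended by [0]. The powers of
    [1 / x] are included because derivatives of members of the family are linear combinations of
    members. *)
Definition flat (m : nat) (x : R) : R :=
  if 0 < x then x^-1 ^+ m * expR (- x^-1) else 0.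

Lemma flat_ge0 m x : 0 <= flat m x.
Proof.
rewrite /flat; case: ifPn => // x0.
by rewrite mulr_ge0 ?expR_ge0// exprn_ge0// invr_ge0 ltW.
Qed.

(** With [y = 1 / x] this is the exponential series bound [y ^ (m + 2) / (m + 2)! <= exp y]. The
    second order in [x] makes the difference quotient at [0] tend to [0]. *)
Lemma flat_le m x : flat m x <= (m.+2)`!%:R * x ^+ 2.
Proof.
rewrite /flat; case: ifPn => [x0|_]; last first.
  by rewrite mulr_ge0// ?sqr_ge0// ler0n.
have y0 : 0 < x^-1 by rewrite invr_gt0.
set y := x^-1 in y0 *.
have -> : x = y^-1 by rewrite invrK.
rewrite expRN ler_pdivrMr ?expR_gt0//.
have fact0 : 0 < (m.+2)`!%:R :> R by rewrite ltr0n fact_gt0.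
have := @expR_ge1Dxn R y m.+1 (ltW y0).
move=> h.
have {h} : y ^+ m.+2 / m.+2`!%:R <= expR y by lra.
rewrite ler_pdivrMr// => h.
have -> : y ^+ m = y^-1 ^+ 2 * y ^+ m.+2.
  by rewrite -(addn2 m) exprD mulrCA -exprMn mulVf ?gt_eqF// expr1n mulr1.
have -> : (m.+2)`!%:R * y^-1 ^+ 2 * expR y =
    y^-1 ^+ 2 * (expR y * (m.+2)`!%:R) by ring.
by rewrite ler_wpM2l ?sqr_ge0//.
Qed.

Lemma is_derive_flat m (x : R) :
  is_derive x 1 (flat m) (flat m.+2 x - m%:R * flat m.+1 x).
Proof.
have [x0|x0|->] := ltgtP x 0.
- have -> : flat m.+2 x - m%:R * flat m.+1 x = 0.
    by rewrite /flat ltNge (ltW x0)/= mulr0 subrr.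
  apply: (@near_eq_is_derive _ _ _ (fun=> 0)).
  near=> y; rewrite /flat ltNge ltW//=.
  by near: y; exact: lt_nbhsl.
- have xneq : x != 0 by rewrite gt_eqF.
  apply: (@near_eq_is_derive _ _ _
    (fun y : R => y^-1 ^+ m * expR (- y^-1))).
    near=> y; rewrite /flat/= ifT//.
    by near: y; exact: lt_nbhsr.
  have dV : is_derive x 1 (fun y : R => y^-1) (- x ^- 2).
    have := @is_deriveV _ id x 1 1 xneq (is_derive_id _ _).
    by rewrite /GRing.scale/= mulr1.
  have dNV : is_derive x 1 (fun y : R => - y^-1) (x ^- 2).
    by have := @is_deriveN _ _ _ _ _ _ _ dV; rewrite opprK.
  have dE := @is_derive1_comp _ expR (fun y : R => - y^-1) x _ _
    (is_derive_expR _) dNV.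
  have dX : is_derive x 1 (fun y : R => (y^-1) ^+ m)
     (m%:R * x^-1 ^+ m.-1 * (- x ^- 2)).
    have := @is_deriveX _ _ (fun y : R => y^-1) m x 1 _ dV.
    rewrite /GRing.scale/=.
    suff -> : (fun y : R => y^-1) ^+ m = (fun y : R => y^-1 ^+ m) by [].
    by apply/funext => y; rewrite exprfctE.
  apply: (is_derive_eq (is_deriveM dX dE)).
  rewrite /GRing.scale/= /flat x0 /= -exprVn.
  set e := expR _; set y := x^-1.
  case: m {dX} => [|m]; rewrite ?expr0 ?mul0r ?mulr0 ?subr0 ?addr0 ?mul1r.
    by rewrite mulrC.
  rewrite /= !exprS; ring.
- have f0 k : flat k 0 = 0 by rewrite /flat ltxx.
  rewrite !f0 mulr0 subrr.
  have cv : h^-1 *: (flat m (h *: (1:R) + 0) - flat m 0) @[h --> 0^'] --> (0:R).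
    apply/cvgr0Pnorm_le => e e0; near=> h.
    have h0 : h != 0 by near: h; exact: nbhs_dnbhs_neq.
    rewrite f0 subr0 addr0 /GRing.scale/= mulr1 normrM normfV.
    rewrite ler_pdivrMl ?normr_gt0// ger0_norm ?flat_ge0//.
    apply: (le_trans (flat_le _ _)).
    have -> : h ^+ 2 = `|h| * `|h|.
      by rewrite -normrM ger0_norm ?expr2// -expr2 sqr_ge0.
    rewrite mulrA mulrC ler_wpM2l//.
    rewrite mulrC -ler_pdivlMr ?ltr0n ?fact_gt0//.
    near: h; apply: dnbhs0_le.
    by rewrite divr_gt0// ltr0n fact_gt0.
  apply: DeriveDef; last exact: cvg_lim cv.
  by apply/cvg_ex; exists 0.
Unshelve. all: by end_near.
Qed.

Lemma iter_derivable_flat n m : iter_derivable n (flat m).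
Proof.
elim: n m => // n IH m.
apply: (iter_derivable_ext (is_derive_flat m)).
have -> : (fun x => flat m.+2 x - m%:R * flat m.+1 x) =
          (fun x => flat m.+2 x + (- m%:R) * flat m.+1 x).
  by apply/funext => x; rewrite mulNr.
apply: iter_derivableD; first exact: IH.
by apply: iter_derivableM; [exact: iter_derivable_cst|exact: IH].
Qed.

(** The factor [k + 1] sharpens both edges, so that the bumps tend pointwise to the indicator of
    []s, t[]. *)
Definition bump (k : nat) (s t x : R) : R :=
  flat 0 (k.+1%:R * (x - s)) * flat 0 (k.+1%:R * (t - x)).

Lemma bump_ge0 k s t x : 0 <= bump k s t x.
Proof. by rewrite mulr_ge0// flat_ge0. Qed.

Lemma flat0_le1 x : flat 0 x <= 1.
Proof.
rewrite /flat; case: ifPn => // x0.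
by rewrite expr0 mul1r -expR0 ler_expR oppr_le0 invr_ge0 ltW.
Qed.

Lemma bump_le1 k s t x : bump k s t x <= 1.
Proof. by rewrite mulr_ile1// ?flat_ge0 ?flat0_le1. Qed.

Lemma bump_out k s t x : x \notin `]s, t[ -> bump k s t x = 0.
Proof.
rewrite in_itv/= negb_and -!leNgt /bump /flat => /orP[h|h].
  by rewrite ltNge pmulr_rle0 ?ltr0n// subr_le0 h mul0r.
by rewrite [X in _ * X]ifF ?mulr0// ltNge pmulr_rle0 ?ltr0n// subr_le0 h.
Qed.

Lemma bump_gt0 k s t x : x \in `]s, t[ -> 0 < bump k s t x.
Proof.
rewrite in_itv/= => /andP[sx xt]; rewrite /bump /flat.
by rewrite !ifT ?mulr_gt0 ?exprn_gt0 ?invr_gt0 ?expR_gt0 ?ltr0n ?subr_gt0//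
  mulr_gt0 ?ltr0n ?subr_gt0.
Qed.

Lemma iter_derivable_bump n k s t : iter_derivable n (bump k s t).
Proof.
have -> : bump k s t = fun x => flat 0 (k.+1%:R * x + - (k.+1%:R * s)) *
   flat 0 (- k.+1%:R * x + k.+1%:R * t).
  by apply/funext => x; rewrite /bump; congr (flat _ _ * flat _ _); ring.
by apply: iter_derivableM; apply: iter_derivable_affine;
  exact: iter_derivable_flat.
Qed.

Lemma cvg_flat0 x : 0 < x -> flat 0 (k.+1%:R * x) @[k --> \oo] --> (1:R).
Proof.
move=> x0.
have -> : (fun k : nat => flat 0 (k.+1%:R * x)) =
          (fun k : nat => expR (- (x^-1 * k.+1%:R^-1))).
  apply/funext => k; rewrite /flat ifT ?mulr_gt0 ?ltr0n//.
  by rewrite expr0 mul1r invfM mulrC.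
rewrite -[X in _ --> X]expR0.
apply: continuous_cvg; first exact: continuous_expR.
rewrite -oppr0; apply: cvgN.
rewrite -(mulr0 x^-1); apply: cvgM; first exact: cvg_cst.
exact: cvg_harmonic.
Qed.

Lemma cvg_bump s t x :
  bump k s t x @[k --> \oo] --> (\1_(`]s, t[%classic) x : R).
Proof.
have [xst|xst] := boolP (x \in `]s, t[).
  rewrite indicE mem_set//= -(mulr1 1).
  move: xst; rewrite in_itv/= => /andP[sx xt].
  by apply: cvgM; apply: cvg_flat0; rewrite subr_gt0.
rewrite indicE memNset//=; last by apply/negP.
have -> : (fun k => bump k s t x) = fun=> 0.
  by apply/funext => k; exact: bump_out.
exact: cvg_cst.
Qed.

Variables a b : R.

Lemma test_functionP phi : (forall n, iter_derivable n phi) ->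
  forall s t, a < s -> t < b ->
  (forall x, x \notin `[s, t] -> phi x = 0) -> test_function a b phi.
Proof.
move=> dphi s t sa tb phi0.
have sub : closure [set x | phi x != 0] `<=` `[s, t]%classic.
  apply: subset_trans (@itv_closed _ _ s t); apply: closureS => x /= /eqP phix.
  by apply: contrapT => /negP xst; apply: phix; exact: phi0.
split; first exact/iter_derivableP.
- apply: subclosed_compact sub; first exact: closed_closure.
  exact: segment_compact.
- move=> x /sub /=; rewrite !in_itv/= => /andP[sx xt].
  by rewrite (lt_le_trans sa)// (le_lt_trans xt).
Qed.

Lemma test_function_bump k s t : a < s -> t < b ->
  test_function a b (bump k s t).
Proof.
move=> sa tb; apply: (@test_functionP _ _ s t) => //.
  by move=> n; exact: iter_derivable_bump.
move=> x xst; apply: bump_out; apply: contra xst.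
exact: subset_itv_oo_cc.
Qed.

Lemma iter_derivable_continuous f : iter_derivable 1 f -> continuous f.
Proof.
move=> [df _] x; apply: differentiable_continuous.
by apply/derivable1_diffP.
Qed.

End smooth_functions.

(** * Finite measures tested against smooth functions *)

Lemma integrable_le_bound {d} {T : measurableType d} {R : realType}
    (m : {measure set T -> \bar R}) (A : set T) (f : T -> R) (M : R) :
  measurable A -> (m A < +oo)%E -> measurable_fun A f ->
  (forall x, A x -> `|f x| <= M) -> m.-integrable A (EFin \o f).
Proof.
move=> mA mAfin mf fM; apply: measurable_bounded_integrable => //.
exists M; split; first exact: num_real.
by move=> N MN x Ax; apply: le_trans (fM _ Ax) (ltW MN).
Qed.

Lemma EFin_Rintegral {d} {T : measurableType d} {R : realType}
    (m : {measure set T -> \bar R}) (A : set T) (f : T -> R) :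
  measurable A -> m.-integrable A (EFin \o f) ->
  (\int[m]_(x in A) (f x)%:E)%E = (\int[m]_(x in A) f x)%:E.
Proof.
by move=> mA intf; rewrite /Rintegral fineK//; exact: integrable_fin_num.
Qed.

(** Equalities of differences [m1 - m2 = n1 - n2] are handled as equalities of sums
    [m1 + n2 = n1 + m2], and these sums have to stay within finite measures. *)
Lemma fin_num_measure_add {d} {T : measurableType d} {R : realType}
    (m1 m2 : {finite_measure set T -> \bar R}) :
  fin_num_fun (measure_add m1 m2).
Proof.
by move=> A mA; rewrite measure_addE fin_numD !fin_num_measure.
Qed.

Section finite_measure_add.
Context {d} {T : measurableType d} {R : realType}.
Variables m1 m2 : {finite_measure set T -> \bar R}.

HB.instance Definition _ := Measure.on (measure_add m1 m2).

HB.instance Definition _ :=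
  Measure_isFinite.Build d T R (measure_add m1 m2)
    (fin_num_measure_add m1 m2).

End finite_measure_add.

Section Jordan_parts.
Context {R : realType} (a b : R).
Local Notation D := `]a, b[%classic.
Implicit Types m n : {finite_measure set R -> \bar R}.

Lemma test_function_continuous phi : test_function a b phi ->
  continuous phi.
Proof.
move=> [dphi _ _] x; apply: differentiable_continuous.
exact/derivable1_diffP/(dphi 0%N).
Qed.

Lemma test_function_derive_continuous phi : test_function a b phi ->
  continuous (derive1 phi).
Proof.
move=> [dphi _ _] x; apply: differentiable_continuous.
exact/derivable1_diffP/(dphi 1%N).
Qed.

Lemma continuous_measurable (A : set R) (f : R -> R) :
  measurable A -> continuous f -> measurable_fun A f.
Proof.
move=> mA cf; apply: subspace_continuous_measurable_fun => //.
exact: continuous_subspaceT.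
Qed.

Lemma continuous_bounded_on_itv (f : R -> R) : continuous f ->
  exists M, forall x, x \in `[a, b] -> `|f x| <= M.
Proof.
move=> cf; have [ab|ba] := leP a b; last first.
  exists 0 => x; rewrite in_itv/= => /andP[ax xb].
  by have := le_lt_trans (le_trans ax xb) ba; rewrite ltxx.
have cf' : {within `[a, b], continuous (fun x => `|f x|)}.
  apply: continuous_subspaceT => x.
  by apply: continuous_comp; [exact: cf|exact: norm_continuous].
have [c cab fc] := EVT_max ab cf'.
by exists `|f c| => x xab; exact: fc.
Qed.

Lemma continuous_integrable m (f : R -> R) : continuous f ->
  m.-integrable D (EFin \o f).
Proof.
move=> cf; have [M fM] := continuous_bounded_on_itv cf.
apply: (@integrable_le_bound _ _ _ _ _ _ M) => //.
- by rewrite -ge0_fin_numE ?measure_ge0// fin_num_measure.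
- exact: continuous_measurable.
- by move=> x /= xab; apply: fM; exact: subset_itv_oo_cc.
Qed.

(** Bumps on []s, t[] are bounded by [1] and tend to the indicator, so dominated convergence passes
    from test functions to intervals. The strict inequalities keep their closed supports inside []a,
    b[]. *)
Lemma eq_measure_itv n1 n2 :
  (forall phi, test_function a b phi ->
    \int[n1]_(x in D) phi x = \int[n2]_(x in D) phi x) ->
  forall s t, a < s -> t < b -> n1 `]s, t[%classic = n2 `]s, t[%classic.
Proof.
move=> n12 s t sa tb.
have cv n : (\int[n]_(x in D) (bump k s t x)%:E)%E @[k --> \oo] -->
            n `]s, t[%classic.
  have -> : n `]s, t[%classic = (\int[n]_(x in D) (\1_(`]s, t[%classic) x)%:E)%E.
    rewrite integral_indic//; congr (n _); apply/esym/setIidl => x /=.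
    rewrite !in_itv/= => /andP[sx xt].
    by rewrite (lt_trans sa)// (lt_trans xt).
  suff [] : [/\ n.-integrable D (fun x => (\1_(`]s, t[%classic) x)%:E),
      (\int[n]_(x in D) `|(bump k s t x)%:E - (\1_(`]s, t[%classic) x)%:E|)%E
         @[k --> \oo] --> 0%E &
      (\int[n]_(x in D) (bump k s t x)%:E)%E @[k --> \oo] -->
      (\int[n]_(x in D) (\1_(`]s, t[%classic) x)%:E)%E] by [].
  apply: (@dominated_convergence _ _ _ n D _ _ _ (cst 1%E)) => //.
  - move=> k; apply/measurable_EFinP; apply: continuous_measurable => //.
    exact: test_function_continuous (test_function_bump k sa tb).
  - by apply/measurable_EFinP; exact: measurable_indic.
  - apply: aeW => x _; apply: cvg_EFin; first by near=> k.
    exact: cvg_bump.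
  - apply: (@integrable_le_bound _ _ _ _ _ (cst 1) 1) => //.
    by rewrite -ge0_fin_numE ?measure_ge0// fin_num_measure.
    by move=> x _; rewrite normr1.
  - apply: aeW => x k _; rewrite /= lee_fin ger0_norm ?bump_ge0//.
    exact: bump_le1.
have := cv n1; have -> : (fun k => \int[n1]_(x in D) (bump k s t x)%:E)%E =
  (fun k => \int[n2]_(x in D) (bump k s t x)%:E)%E.
  apply/funext => k.
  have tk := test_function_bump k sa tb.
  rewrite !EFin_Rintegral//; first by rewrite n12.
    by apply: continuous_integrable; exact: test_function_continuous.
  by apply: continuous_integrable; exact: test_function_continuous.
move=> c1; apply: (cvg_unique _ c1 (cv n2)).
Unshelve. all: by end_near.
Qed.

Lemma eq_measure_of_itv n1 n2 :
  (forall s t, a < s -> t < b -> n1 `]s, t[%classic = n2 `]s, t[%classic) ->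
  forall A, measurable A -> A `<=` D -> n1 A = n2 A.
Proof.
move=> n12 A mA AD.
have mD : measurable D by [].
(* Intervals that may touch the endpoints are exhausted from inside, by moving both ends inwards by
   [1 / (k + 1)]. *)
have n12' s t : a <= s -> t <= b -> n1 `]s, t[%classic = n2 `]s, t[%classic.
  move=> sa tb.
  pose F (k : nat) : set R := `]s + k.+1%:R^-1, t - k.+1%:R^-1[%classic.
  have UF : \bigcup_k F k = `]s, t[%classic.
    apply/seteqP; split => x /=.
      move=> [k _]; rewrite /F/= !in_itv/= => /andP[].
      have : 0 < k.+1%:R^-1 :> R by rewrite invr_gt0 ltr0n.
      by move: (k.+1%:R^-1) => e h1 h2 h3; apply/andP; split; lra.
    rewrite in_itv/= => /andP[sx xt].
    have e0 : 0 < Num.min (x - s) (t - x) by rewrite lt_min !subr_gt0 sx.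
    have [k _ /(_ k (leqnn _)) /=] := near_infty_natSinv_lt (PosNum e0).
    rewrite lt_min => /andP[k1 k2]; exists k => //.
    rewrite /F/= in_itv/=.
    by move: (k.+1%:R^-1) k1 k2 => e k1 k2; apply/andP; split; lra.
  have ndF : nondecreasing_seq F.
    move=> i j ij; apply/subsetPset => x; rewrite /F/= !in_itv/=.
    have : j.+1%:R^-1 <= i.+1%:R^-1 :> R.
      by rewrite lef_pV2 ?posrE ?ltr0n// ler_nat.
    move: (i.+1%:R^-1) (j.+1%:R^-1) => e e' ? /andP[? ?].
    by apply/andP; split; lra.
  have cv n : (n \o F) k @[k --> \oo] --> n `]s, t[%classic.
    rewrite -UF; apply: nondecreasing_cvg_mu => //.
    by move=> i; exact: measurable_itv.
    by rewrite UF.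
  have := cv n1; have -> : n1 \o F = n2 \o F.
    apply/funext => k /=; apply: n12.
      by rewrite (le_lt_trans sa)// ltrDl invr_gt0 ltr0n.
    by rewrite (lt_le_trans _ tb)// ltrBlDr ltrDl invr_gt0 ltr0n.
  by move=> c1; apply: (cvg_unique _ c1 (cv n2)).
rewrite -(setIidl AD).
(* Uniqueness of measures is applied to the restrictions to []a, b[]: open intervals form a
   generating family stable under intersection, and their traces on []a, b[] are the intervals
   treated above. *)
change (mrestr n1 mD A = mrestr n2 mD A).
apply: (measure_unique (@RGenOpens.G R)
  (fun k : nat => `](- k%:R), k%:R[%classic)) => //.
- exact: RGenOpens.measurableE.
- move=> _ _ [x [y ->]] [z [w ->]].
  exists (Num.max x z), (Num.min y w); apply/seteqP; split => r /=.
    by rewrite !in_itv/= gt_max lt_min => -[/andP[-> ->] /andP[-> ->]].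
  by rewrite !in_itv/= gt_max lt_min => /andP[/andP[-> ->] /andP[-> ->]].
- by move=> k; exists (- k%:R), k%:R.
- exact: bigcup_itvT.
- move=> _ [x [y ->]].
  change (n1 (`]x, y[%classic `&` D) = n2 (`]x, y[%classic `&` D)).
  have -> : `]x, y[%classic `&` D = `]Num.max x a, Num.min y b[%classic.
    apply/seteqP; split => r /=.
      by rewrite !in_itv/= gt_max lt_min => -[/andP[-> ->] /andP[-> ->]].
    by rewrite !in_itv/= gt_max lt_min => /andP[/andP[-> ->] /andP[-> ->]].
  by apply: n12'; rewrite ?le_max ?ge_min lexx orbT.
- move=> k; rewrite /mrestr -ge0_fin_numE ?measure_ge0// fin_num_measure//.
Qed.

Lemma eq_measure_test n1 n2 :
  (forall phi, test_function a b phi ->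
    \int[n1]_(x in D) phi x = \int[n2]_(x in D) phi x) ->
  forall A, measurable A -> A `<=` D -> n1 A = n2 A.
Proof. by move=> /eq_measure_itv /eq_measure_of_itv. Qed.

End Jordan_parts.

(** * Distribution functions and Fubini *)

Section primitive.
Context {R : realType} (a b : R).
Local Notation D := `]a, b[%classic.
Local Notation mu := (@lebesgue_measure R).
Implicit Types m n : {finite_measure set R -> \bar R}.

(** For a Dirac mass at a point [s > a] this is the Heaviside function jumping at [s]. *)
Definition cdf_from m (x : R) : R := fine (m `]a, x]%classic).

Definition tail_integral (h : R -> R) (s : R) : R := \int[mu]_(x in `]s, b[) h x.

Lemma cdf_from_homo m : {homo cdf_from m : x y / x <= y}.
Proof.
move=> x y xy; rewrite /cdf_from fine_le ?fin_num_measure//.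
apply: le_measure; rewrite ?inE//.
by apply: subset_itvl; rewrite bnd_simp.
Qed.

Lemma cdf_from_ge0 m x : 0 <= cdf_from m x.
Proof. by rewrite fine_ge0. Qed.

Lemma cdf_from_le m x : cdf_from m x <= fine (m setT).
Proof.
by rewrite /cdf_from fine_le ?fin_num_measure//; apply: le_measure; rewrite ?inE.
Qed.

Lemma measurable_cdf_from m A : measurable A -> measurable_fun A (cdf_from m).
Proof.
move=> mA; apply: (@measurable_funS _ _ _ _ setT) => //.
exact: nondecreasing_measurable (cdf_from_homo m).
Qed.

Lemma integrable_tail (h : R -> R) s : a <= s ->
  mu.-integrable D (EFin \o h) -> mu.-integrable `]s, b[ (EFin \o h).
Proof.
move=> as_; apply: integrableS => //.
by apply: subset_itvr; rewrite bnd_simp.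
Qed.

(** Integration by parts, obtained by exchanging the integrals of [h x] over the region
    [a < s <= x < b]: integrating in [s] first produces the distribution function, in [x] first the
    tail. *)
Lemma Fubini_cdf m (h : R -> R) : mu.-integrable D (EFin \o h) ->
  [/\ mu.-integrable D (EFin \o (fun x => h x * cdf_from m x)),
      m.-integrable D (EFin \o tail_integral h) &
      \int[mu]_(x in D) (h x * cdf_from m x) =
        \int[m]_(s in D) tail_integral h s].
Proof.
move=> inth.
have inthc : mu.-integrable D (EFin \o (fun x => h x * cdf_from m x)).
  apply: (@integrableMl _ _ _ mu D _ (EFin \o h) (cdf_from m)) => //.
    exact: measurable_cdf_from.
  exists (fine (m setT)); split; first exact: num_real.
  move=> M mM x _ /=; rewrite ger0_norm ?cdf_from_ge0//.
  exact: le_trans (cdf_from_le _ _) (ltW mM).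
have intH : mu.-integrable setT (EFin \o (h \_ D)).
  by rewrite -restrict_EFin; apply: (integrable_mkcond _ _).1.
pose E := [set p : R * R | (a < p.2) && (p.2 <= p.1)].
have mE : measurable E.
  rewrite -[E]setTI.
  have : measurable_fun setT (fun p : R * R => (a < p.2) && (p.2 <= p.1)).
    apply: measurable_and.
      by apply: measurable_fun_ltr => //; exact: measurable_snd.
    by apply: measurable_fun_ler; [exact: measurable_snd|exact: measurable_fst].
  by move=> /(_ measurableT [set true]); apply.
pose K (p : R * R) : \bar R := ((h \_ D) p.1 * \1_E p)%:E.
have mK : measurable_fun setT K.
  apply/measurable_EFinP; apply: measurable_funM.
    apply: (measurableT_comp _ measurable_fst).
    by apply/measurable_EFinP; exact: measurable_int intH.
  exact: measurable_indic.
have K1 (c x : R) : (\int[m]_s (c * \1_E (x, s))%:E)%E = (c * cdf_from m x)%:E.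
  have -> : (fun s => (c * \1_E (x, s))%:E) =
            (fun s => c%:E * (\1_(`]a, x]%classic) s)%:E)%E.
    apply/funext => s; rewrite -EFinM !indicE.
    suff -> : ((x, s) \in E) = (s \in `]a, x]%classic) by [].
    by apply/idP/idP; rewrite !inE/= ?in_itv.
  rewrite integralZl//; last exact: integrable_indic.
  by rewrite integral_indic// setIT EFinM /cdf_from fineK// fin_num_measure.
have K2 s : (\int[mu]_x K (x, s))%E = ((tail_integral h \_ D) s)%:E.
  have [Ds|nDs] := boolP (s \in D); last first.
    rewrite patchE (negbTE nDs) integral0_eq// => x _.
    rewrite /K/= patchE indicE; case: ifPn; rewrite ?mul0r//= => Dx.
    case: (boolP ((x, s) \in E)); rewrite ?mulr0// inE /E/= => /andP[as_ sx].
    move: nDs; rewrite notin_setE /= => -[]; rewrite in_itv/= as_/=.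
    by move: Dx; rewrite inE/= in_itv/= => /andP[_]; exact: le_lt_trans.
  have as_ : a < s by move: Ds; rewrite inE/= in_itv/= => /andP[].
  have ints := integrable_tail (ltW as_) inth.
  rewrite patchE Ds /tail_integral -EFin_Rintegral//.
  (* The section of [E] at [s] gives [[s, b[], while the tail runs over []s, b[]; a single point is
     Lebesgue null. *)
  rewrite integral_itv_obnd_cbnd; last first.
    exact: measurable_int ints.
  rewrite [RHS]integral_mkcond; apply: eq_integral => x _.
  rewrite /K/= restrict_EFin/= !patchE indicE; congr EFin.
  case: (boolP (x \in `[s, b[%classic)).
    rewrite inE/= in_itv/= => /andP[sx xb].
    have xD : x \in D by rewrite inE/= in_itv/= xb (lt_le_trans as_ sx).
    have xE : (x, s) \in E by rewrite inE /E/= as_.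
    by rewrite xD xE mulr1.
  rewrite notin_setE/= in_itv/= => /negP nx.
  case: (boolP (x \in D)); last by rewrite mul0r.
  rewrite inE/= in_itv/= => /andP[ax xb].
  have xE : (x, s) \notin E.
    by rewrite notin_setE /E/= as_/= => sx; move: nx; rewrite sx xb.
  by rewrite (negbTE xE) mulr0.
have intK : (mu \x m)%E.-integrable setT K.
  apply/integrable12ltyP => //.
  rewrite (_ : (fun x => _) = (fun x => (`|(h \_ D) x| * cdf_from m x)%:E)).
    have : mu.-integrable setT (EFin \o (fun x => (h \_ D) x * cdf_from m x)).
      apply: (@integrableMl _ _ _ mu setT _ (EFin \o (h \_ D)) (cdf_from m)) => //.
        exact: measurable_cdf_from.
      exists (fine (m setT)); split; first exact: num_real.
      move=> M mM x _ /=; rewrite ger0_norm ?cdf_from_ge0//.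
      exact: le_trans (cdf_from_le _ _) (ltW mM).
    move=> /integrableP[_]; congr (_ < _)%E; apply: eq_integral => x _ /=.
    by rewrite normrM [X in _ * X]ger0_norm// cdf_from_ge0.
  apply/funext => x; rewrite -K1; apply: eq_integral => s _.
  by rewrite /K/= normrM [X in _ * X]ger0_norm.
have := Fubini intK.
under eq_integral do rewrite /K/= K1.
under [RHS]eq_integral do rewrite K2.
move=> F.
have intt : m.-integrable D (EFin \o tail_integral h).
  apply: (@integrable_le_bound _ _ _ _ _ _ (\int[mu]_(x in D) `|h x|)) => //.
  - by rewrite -ge0_fin_numE ?measure_ge0// fin_num_measure.
  (* Measurability of the tail is read off from the marginal of the product integral. *)
  - have := measurable_fubini_G intK.
    have -> : fubini_G mu K = EFin \o (tail_integral h \_ D).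
      by apply/funext => s; rewrite /fubini_G K2.
    by move=> /measurable_EFinP; rewrite -measurable_restrictT.
  - move=> s /=; rewrite in_itv/= => /andP[as_ sb].
    have ints := integrable_tail (ltW as_) inth.
    apply: le_trans (le_normr_Rintegral _ ints) _ => //.
    rewrite -lee_fin -!EFin_Rintegral//; last 2 first.
    - exact: integrable_abse inth.
    - exact: integrable_abse ints.
    apply: ge0_subset_integral => //.
    + by have /measurable_int := integrable_abse inth.
    + by apply: subset_itvr; rewrite bnd_simp ltW.
split=> //.
rewrite /Rintegral; congr fine.
rewrite [LHS]integral_mkcond [RHS]integral_mkcond.
transitivity (\int[mu]_x ((h \_ D) x * cdf_from m x)%:E)%E.
  by apply: eq_integral => x _; rewrite !patchE; case: ifPn => //; rewrite mul0r.
rewrite F; apply: eq_integral => x _.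
by rewrite !patchE; case: ifPn.
Qed.

End primitive.

(** * Distributional derivatives as differences of measures *)

Section derivative_pair.
Context {R : realType} (a b : R).
Local Notation D := `]a, b[%classic.
Local Notation mu := (@lebesgue_measure R).
Implicit Types m n : {finite_measure set R -> \bar R}.

Definition carried m := forall A, measurable A -> m A = m (A `&` D).

(* The two measures need not be mutually singular: they dominate the Jordan parts
   of the derivative, so any pair bounds the weighted variation from above. *)
Definition derivative_pair (u : R -> R) m1 m2 :=
  [/\ carried m1, carried m2 & forall phi, test_function a b phi ->
    \int[mu]_(x in D) (u x * derive1 phi x) =
    \int[m2]_(x in D) phi x - \int[m1]_(x in D) phi x].

Lemma integrable_mul_continuous (u f : R -> R) :
  mu.-integrable D (EFin \o u) -> continuous f ->
  mu.-integrable D (EFin \o (fun x => u x * f x)).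
Proof.
move=> intu cf; apply: (@integrableMl _ _ _ mu D _ (EFin \o u) f) => //.
  exact: continuous_measurable.
have [M fM] := continuous_bounded_on_itv a b cf.
exists M; split; first exact: num_real.
move=> N MN x /= xD; apply: le_trans (ltW MN).
by apply: fM; exact: subset_itv_oo_cc.
Qed.

Lemma Rintegral_measure_add m1 m2 (f : R -> R) : continuous f ->
  \int[measure_add m1 m2]_(x in D) f x =
  \int[m1]_(x in D) f x + \int[m2]_(x in D) f x.
Proof.
move=> cf; apply: EFin_inj.
have i1 := continuous_integrable a b m1 cf.
have i2 := continuous_integrable a b m2 cf.
have i12 := continuous_integrable a b (measure_add m1 m2) cf.
by rewrite EFinD -!EFin_Rintegral// integral_measure_add.
Qed.

Lemma charge_integralE (nu : {charge set R -> \bar R}) (f : R -> R) :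
  continuous f ->
  charge_integral nu D (EFin \o f) =
  (\int[jordan_pos (hahnP nu)]_(x in D) f x -
   \int[jordan_neg (hahnP nu)]_(x in D) f x)%:E.
Proof.
move=> cf; rewrite /charge_integral !EFin_Rintegral ?EFinB//.
  exact: continuous_integrable.
exact: continuous_integrable.
Qed.

Definition charge_pos (nu : {charge set R -> \bar R}) :
  {finite_measure set R -> \bar R} := jordan_pos (hahnP nu).

Definition charge_neg (nu : {charge set R -> \bar R}) :
  {finite_measure set R -> \bar R} := jordan_neg (hahnP nu).

(** Exposes the Hahn sets behind the Jordan parts, so that other pairs can be compared with them on
    [P] and on [N]. *)
Lemma charge_pos_negE (nu : {charge set R -> \bar R}) :
  exists P N : set R, [/\ measurable P, measurable N &
  forall A, measurable A ->
    charge_pos nu A = nu (A `&` P) /\ charge_neg nu A = (- nu (A `&` N))%E].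
Proof.
have [[mP _] [mN _] _ _] := hahnP nu.
exists ((projT1 (cid (hahn_decomposition_ex nu))).1).
exists ((projT1 (cid (hahn_decomposition_ex nu))).2).
split=> // A mA; split.
  transitivity (crestr0 nu mP A); last by rewrite /crestr0 mem_set.
  by rewrite /charge_pos/= jordan_posE cjordan_posE /crestr0 mem_set// mem_set.
transitivity (- crestr0 nu mN A)%E; last by rewrite /crestr0 mem_set.
by rewrite /charge_neg/= jordan_negE cjordan_negE /crestr0 mem_set// mem_set.
Qed.

Lemma charge_pos_neg_decomp (nu : {charge set R -> \bar R}) A : measurable A ->
  nu A = (charge_pos nu A - charge_neg nu A)%E.
Proof.
by move=> mA; rewrite (jordan_decomp (hahnP nu) mA) /cadd/= cscaleN1.
Qed.

Lemma derivative_pair_jordan u (nu : {charge set R -> \bar R}) :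
  mu.-integrable D (EFin \o u) -> is_distributional_derivative a b u nu ->
  derivative_pair u (charge_pos nu) (charge_neg nu).
Proof.
move=> intu [nuD nuphi].
have [P [N [mP mN nuPN]]] := charge_pos_negE nu.
split.
- move=> A mA; rewrite (nuPN _ mA).1 (nuPN _ _).1; last exact: measurableI.
  by rewrite nuD; [rewrite setIAC|exact: measurableI].
- move=> A mA; rewrite (nuPN _ mA).2 (nuPN _ _).2; last exact: measurableI.
  by rewrite nuD; [rewrite setIAC|exact: measurableI].
- move=> phi tphi; have := nuphi phi tphi.
  rewrite charge_integralE; last exact: test_function_continuous tphi.
  rewrite EFin_Rintegral//; last first.
    apply: integrable_mul_continuous => //.
    exact: test_function_derive_continuous tphi.
  by rewrite -EFinN => -[->]; rewrite opprB.
Qed.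

Definition charge_of_pair m1 m2 : {charge set R -> \bar R} :=
  cadd (charge_of_finite_measure m1)
       (cscale (-1) (charge_of_finite_measure m2)).

Lemma charge_of_pairE m1 m2 A : charge_of_pair m1 m2 A = (m1 A - m2 A)%E.
Proof.
by rewrite -[LHS]/(m1 A + (-1)%:E * m2 A)%E EFinN mulN1e.
Qed.

Lemma eq_cross_add m1 m2 n1 n2 A : measurable A ->
  (m1 A - m2 A = n1 A - n2 A)%E ->
  measure_add m1 n2 A = measure_add n1 m2 A.
Proof.
move=> mA; rewrite !measure_addE.
change ((m1 A - m2 A = n1 A - n2 A)%E -> (m1 A + n2 A = n1 A + m2 A)%E).
have F m : m A = (fine (m A))%:E by rewrite fineK// fin_num_measure.
rewrite (F m1) (F m2) (F n1) (F n2) => -[h].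
by rewrite -!EFinD; congr EFin; lra.
Qed.

(** The charge integral uses the Jordan parts of [m1 - m2], which may differ from [m1] and [m2].
    Both pairs have the same difference, so the crossed sums coincide as measures, and so do their
    integrals of [phi]. *)
Lemma derivative_pair_is_distributional u m1 m2 :
  mu.-integrable D (EFin \o u) -> derivative_pair u m1 m2 ->
  is_distributional_derivative a b u (charge_of_pair m1 m2).
Proof.
move=> intu [c1 c2 dphi]; set nu := charge_of_pair m1 m2.
split=> [A mA|phi tphi]; first by rewrite !charge_of_pairE -c1// -c2.
have cphi := test_function_continuous tphi.
rewrite charge_integralE// -EFinN EFin_Rintegral//; last first.
  apply: integrable_mul_continuous => //.
  exact: test_function_derive_continuous tphi.
congr EFin; rewrite dphi//.
have : \int[measure_add (charge_pos nu) m2]_(x in D) phi x =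
       \int[measure_add m1 (charge_neg nu)]_(x in D) phi x.
  rewrite /Rintegral; congr fine; apply: eq_measure_integral => A mA _.
  by apply: eq_cross_add => //; rewrite -charge_pos_neg_decomp// charge_of_pairE.
rewrite !Rintegral_measure_add// /charge_pos /charge_neg => h.
lra.
Qed.

(** The crossed sums have equal integrals against every test function, hence agree inside []a, b[];
    being carried by []a, b[] settles the other Borel sets. *)
Lemma derivative_pair_unique u m1 m2 n1 n2 :
  derivative_pair u m1 m2 -> derivative_pair u n1 n2 ->
  forall A, measurable A -> measure_add m1 n2 A = measure_add n1 m2 A.
Proof.
move=> [cm1 cm2 dm] [cn1 cn2 dn].
suff H A : measurable A -> A `<=` D ->
    measure_add m1 n2 A = measure_add n1 m2 A.
  move=> A mA; have := H (A `&` D) (measurableI _ _ mA (measurable_itv _)).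
  rewrite !measure_addE.
  change ((A `&` D `<=` D ->
    (m1 (A `&` D) + n2 (A `&` D) = n1 (A `&` D) + m2 (A `&` D))%E) ->
    (m1 A + n2 A = n1 A + m2 A)%E).
  rewrite -cm1// -cm2// -cn1// -cn2//; apply.
  exact: subIsetr.
move=> mA AD.
apply: (@eq_measure_test R a b (measure_add m1 n2) (measure_add n1 m2)) => //.
move=> phi tphi.
have cphi := test_function_continuous tphi.
rewrite !Rintegral_measure_add//.
have := dm _ tphi; rewrite dn// => h.
lra.
Qed.

(** The existence of a pair rules out the default value [czero]. *)
Lemma distributional_derivative_pair u m1 m2 :
  mu.-integrable D (EFin \o u) -> derivative_pair u m1 m2 ->
  is_distributional_derivative a b u (distributional_derivative a b u).
Proof.
move=> intu um12; rewrite /distributional_derivative.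
case: pselect => [e|[]]; first exact: projT2 (cid e).
by exists (charge_of_pair m1 m2); exact: derivative_pair_is_distributional.
Qed.

(** Minimality of the Jordan decomposition: the positive part of [A] is
    [nu (A & P) = m1 (A & P) - m2 (A & P)], where [&] stands for intersection, and this is at most
    [m1 A]; likewise on [N]. *)
Lemma charge_pos_neg_le u m1 m2 (nu : {charge set R -> \bar R}) :
  mu.-integrable D (EFin \o u) -> derivative_pair u m1 m2 ->
  is_distributional_derivative a b u nu ->
  forall A, measurable A ->
    (charge_pos nu A <= m1 A)%E /\ (charge_neg nu A <= m2 A)%E.
Proof.
move=> intu um12 unu A mA.
have unu' := derivative_pair_jordan intu unu.
have nuE B : measurable B -> nu B = (m1 B - m2 B)%E.
  move=> mB; have := derivative_pair_unique um12 unu' mB.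
  rewrite !measure_addE charge_pos_neg_decomp//.
  change ((m1 B + charge_neg nu B = charge_pos nu B + m2 B)%E ->
          (charge_pos nu B - charge_neg nu B = m1 B - m2 B)%E).
  have F m : m B = (fine (m B))%:E by rewrite fineK// fin_num_measure.
  rewrite (F m1) (F m2) (F (charge_pos nu)) (F (charge_neg nu)) -!EFinD => -[h].
  by congr EFin; lra.
have [P [N [mP mN nuPN]]] := charge_pos_negE nu.
have mAP := measurableI _ _ mA mP.
have mAN := measurableI _ _ mA mN.
rewrite (nuPN _ mA).1 (nuPN _ mA).2 !nuE// fin_num_oppeB ?fin_num_measure//.
split.
  apply: (@le_trans _ _ (m1 (A `&` P))).
    by rewrite leeBlDr ?fin_num_measure// leeDl.
  by apply: le_measure; rewrite ?inE.
apply: (@le_trans _ _ (m2 (A `&` N))).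
  by rewrite addeC leeBlDr ?fin_num_measure// leeDl.
by apply: le_measure; rewrite ?inE.
Qed.

End derivative_pair.

(** * The du Bois-Reymond lemma *)

Section primitives_of_pairs.
Context {R : realType} (a b : R).
Local Notation D := `]a, b[%classic.
Local Notation mu := (@lebesgue_measure R).
Implicit Types m n : {finite_measure set R -> \bar R}.

Lemma continuous_integrable_itv (f : R -> R) (s t : R) (b1 b2 : bool) :
  continuous f ->
  mu.-integrable [set` Interval (BSide b1 s) (BSide b2 t)] (EFin \o f).
Proof.
move=> cf; apply: (@integrableS _ _ _ mu `[s, t]%classic) => //.
  by apply: subset_itv; rewrite ?bnd_simp; case: b1 b2 => [] []; rewrite ?bnd_simp.
apply: continuous_compact_integrable; first exact: segment_compact.
exact: continuous_subspaceT.
Qed.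

Lemma Rintegral_derive (F f : R -> R) s t : s <= t ->
  (forall x : R, is_derive x 1 F (f x)) -> continuous f ->
  \int[mu]_(x in `]s, t[) f x = F t - F s.
Proof.
rewrite le_eqVlt => /orP[/eqP <- _ _|st dF cf].
  by rewrite set_itv_ge ?bnd_simp ?ltxx// Rintegral_set0 subrr.
have cF : continuous F.
  move=> x; apply: differentiable_continuous; apply/derivable1_diffP.
  by have [] := dF x.
rewrite Rintegral_itv_obnd_cbnd; last exact: continuous_integrable_itv.
rewrite Rintegral_itv_bndo_bndc; last exact: continuous_integrable_itv.
apply: EFin_inj; rewrite -EFin_Rintegral//; last exact: continuous_integrable_itv.
rewrite (@continuous_FTC2 _ f F)//.
- exact: continuous_subspaceT.
- split.
  + by move=> x _; have [] := dF x.
  + by apply: cvg_at_right_filter; exact: cF.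
  + by apply: cvg_at_left_filter; exact: cF.
- by move=> x _; rewrite derive1E; have [] := dF x.
Qed.

Lemma test_function_is_derive phi : test_function a b phi ->
  forall x : R, is_derive x 1 phi (derive1 phi x).
Proof.
by move=> [dphi _ _] x; apply: is_derive1_derivable; exact: (dphi 0%N).
Qed.

Lemma test_function_out phi x : test_function a b phi ->
  x \notin `]a, b[ -> phi x = 0.
Proof.
move=> [_ _ sub] /negP xD; apply: contrapT => /eqP phix; apply: xD.
by apply: sub; exact: subset_closure.
Qed.

Lemma tail_test_function phi s : test_function a b phi -> s <= b ->
  tail_integral b (derive1 phi) s = - phi s.
Proof.
move=> tphi sb; rewrite /tail_integral.
rewrite (Rintegral_derive sb (test_function_is_derive tphi)).
  by rewrite (test_function_out tphi) ?sub0r// in_itv/= ltxx andbF.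
exact: test_function_derive_continuous tphi.
Qed.

Lemma integrable_cdf_from m : mu.-integrable D (EFin \o cdf_from a m).
Proof.
have i1 : mu.-integrable D (EFin \o (fun=> 1 : R)).
  by apply: continuous_integrable_itv => x; exact: cvg_cst.
have [+ _ _] := Fubini_cdf m i1.
by congr (_.-integrable _ _); apply/funext => x /=; rewrite mul1r.
Qed.

(** Fubini applied to [phi'], whose tail is [- phi]: the distribution function has [m] as its
    derivative. *)
Lemma cdf_from_test m phi : test_function a b phi ->
  \int[mu]_(x in D) (cdf_from a m x * derive1 phi x) =
  - \int[m]_(x in D) phi x.
Proof.
move=> tphi.
have cphi' := test_function_derive_continuous tphi.
have intphi' : mu.-integrable D (EFin \o derive1 phi).
  exact: continuous_integrable_itv.
have [_ _ F] := Fubini_cdf m intphi'.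
under eq_Rintegral do rewrite mulrC.
rewrite F -mulN1r -RintegralZl//; last first.
  by apply: continuous_integrable; exact: test_function_continuous tphi.
apply: eq_Rintegral => s; rewrite inE/= in_itv/= => /andP[_ sb].
by rewrite (tail_test_function tphi) ?mulN1r// ltW.
Qed.

Lemma cdf_pair m1 m2 : carried a b m1 -> carried a b m2 ->
  derivative_pair a b (fun x => cdf_from a m1 x - cdf_from a m2 x) m1 m2.
Proof.
move=> c1 c2; split=> // phi tphi.
have cphi' := test_function_derive_continuous tphi.
under eq_Rintegral do rewrite mulrBl.
rewrite RintegralB//; last 2 first.
- exact: integrable_mul_continuous (integrable_cdf_from m1) cphi'.
- exact: integrable_mul_continuous (integrable_cdf_from m2) cphi'.
by rewrite !cdf_from_test//; ring.
Qed.

Lemma Rintegral_supp (g : R -> R) (A S : set R) : S `<=` A ->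
  (forall x, ~ S x -> g x = 0) ->
  \int[mu]_(x in A) g x = \int[mu]_(x in S) g x.
Proof.
move=> SA g0; rewrite Rintegral_mkcond [RHS]Rintegral_mkcond.
apply: eq_Rintegral => x _; rewrite !patchE.
case: (boolP (x \in S)) => xS.
  by rewrite mem_set//; apply: SA; rewrite -in_setE.
by case: ifPn => // _; rewrite g0//; move/negP: xS; rewrite in_setE.
Qed.

(* Subtracting from a bump a multiple of a fixed bump [psi] makes its integral
   vanish, so that its primitive is again a test function. *)
Lemma du_Bois_Reymond (z : R -> R) : a < b -> mu.-integrable D (EFin \o z) ->
  (forall phi, test_function a b phi ->
    \int[mu]_(x in D) (z x * derive1 phi x) = 0) ->
  exists C, {ae mu, forall x, x \in D -> z x = C}.
Proof.
move=> ab intz z0.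
(* The middle third: any interval with closure inside []a, b[] could carry the reference bump. *)
pose s0 := a + (b - a) / 3; pose t0 := b - (b - a) / 3.
have as0 : a < s0 by rewrite /s0; lra.
have st0 : s0 < t0 by rewrite /s0 /t0; lra.
have tb0 : t0 < b by rewrite /t0; lra.
pose psi := bump 0 s0 t0.
have cbump k s t : continuous (@bump R k s t).
  by apply: iter_derivable_continuous; exact: iter_derivable_bump.
have ibump k s t : mu.-integrable D (EFin \o bump k s t).
  exact: continuous_integrable_itv.
pose I := \int[mu]_(x in D) psi x.
(* If the integral were [0], the bump would vanish almost everywhere, yet it is positive on an
   interval of positive length. *)
have I0 : 0 < I.
  rewrite lt_neqAle Rintegral_ge0 ?andbT; last by move=> x _; exact: bump_ge0.
  apply/negP => /eqP I0.
  have : (\int[mu]_(x in D) `|(psi x)%:E|)%E = 0%E.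
    under eq_integral do rewrite gee0_abs ?lee_fin ?bump_ge0//.
    by rewrite EFin_Rintegral ?ibump// -/I -I0.
  have mpsi : measurable_fun D (EFin \o psi) := measurable_int mu (ibump 0 s0 t0).
  move=> /(ae_eq_integral_abs mu (measurable_itv _) mpsi).1 [N [mN N0 sN]].
  have : (mu `]s0, t0[%classic <= mu N)%E.
    apply: le_measure; rewrite ?inE// => x xst; apply: sN => /= h.
    have p0 : 0 < psi x by exact: bump_gt0.
    have : D x.
      move: xst; rewrite /= !in_itv/= => /andP[? ?].
      by rewrite (lt_trans as0)// (lt_trans _ tb0).
    by move=> /h [] px0; move: p0; rewrite px0 ltxx.
  by rewrite N0 lebesgue_measure_itv/= lte_fin st0 -EFinB lee_fin
    leNgt subr_gt0 st0.
pose C := (\int[mu]_(x in D) (z x * psi x)) / I.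
have zbump k s t : a < s -> t < b ->
  \int[mu]_(x in D) (z x * bump k s t x) = C * \int[mu]_(x in D) bump k s t x.
  move=> sa tb.
  pose r := (\int[mu]_(x in D) bump k s t x) / I.
  pose g x := bump k s t x - r * psi x.
  have cg : continuous g.
    move=> x; apply: cvgB; first exact: cbump.
    by apply: cvgM; [exact: cvg_cst|exact: cbump].
  pose phi x := \int[mu]_(y in `[a, x]) g y.
  have intg A : measurable A -> A `<=` D -> mu.-integrable A (EFin \o g).
    move=> mA AD; apply: (@integrableS _ _ _ mu D) => //.
    exact: continuous_integrable_itv.
  have Dg : \int[mu]_(x in D) g x = 0.
    rewrite RintegralB//; last by apply: (integrableZl _ r (ibump 0 s0 t0)).
    rewrite RintegralZl//; last exact: ibump.
    change (\int[mu]_(x in D) bump k s t x - r * I = 0).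
    by rewrite /r divfK ?subrr// gt_eqF.
  (* [[s1, t1]] contains the supports of both bumps. The primitive [phi] of [g] vanishes to its left
     by construction and to its right because [g] has zero integral. *)
  pose s1 := Num.min s s0; pose t1 := Num.max t t0.
  have as1 : a < s1 by rewrite lt_min sa.
  have tb1 : t1 < b by rewrite gt_max tb.
  have g0 x : ~ `[s1, t1]%classic x -> g x = 0.
    rewrite /= in_itv/= => xst; rewrite /g /psi !bump_out ?mulr0 ?subr0//.
      apply/negP; rewrite in_itv/= => /andP[h1 h2]; apply: xst.
      by rewrite /s1 /t1 ge_min le_max (ltW h1) (ltW h2) !orbT.
    apply/negP; rewrite in_itv/= => /andP[h1 h2]; apply: xst.
    by rewrite /s1 /t1 ge_min le_max (ltW h1) (ltW h2).
  have phil x : x <= s1 -> phi x = 0.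
    move=> xs1; rewrite /phi /Rintegral integral0_eq// => y /=.
    rewrite in_itv/= => /andP[ay yx].
    have [ys|sy] := ltP y s1.
      by rewrite g0//= in_itv/= leNgt ys.
    have -> : y = s1 by apply/eqP; rewrite eq_le sy (le_trans yx).
    rewrite /g /psi !bump_out ?mulr0 ?subr0//.
      by rewrite in_itv/= ltNge /s1 ge_min lexx orbT.
    by rewrite in_itv/= ltNge /s1 ge_min lexx.
  have phir x : t1 <= x -> phi x = 0.
    move=> t1x; rewrite -Dg /phi.
    rewrite (@Rintegral_supp g `[a, x] `[s1, t1])//; last first.
      by apply: subset_itv; rewrite bnd_simp// ltW.
    rewrite (@Rintegral_supp g D `[s1, t1])//.
    by apply: subset_itv; rewrite bnd_simp.
  have dphi (x : R) : is_derive x 1 phi (g x).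
    have [ax|xa] := ltP a x.
      have xx1 : x < x + 1 by rewrite ltrDl.
      have intgx : mu.-integrable `[a, x + 1] (EFin \o g).
        exact: continuous_integrable_itv.
      have [d1 d2] := continuous_FTC1_closed xx1 intgx ax (cg x).
      by rewrite -d2 derive1E; exact: derivableP.
    have xs1 : x < s1 by exact: le_lt_trans as1.
    rewrite g0/=; last by rewrite in_itv/= leNgt xs1.
    apply: (@near_eq_is_derive _ _ _ (fun=> 0)).
    by near=> y; rewrite phil// ltW//; near: y; exact: lt_nbhsl.
  have tphi : test_function a b phi.
    apply: (@test_functionP _ a b phi _ s1 t1) => //; last first.
      move=> x; rewrite in_itv/= negb_and -!ltNge => /orP[/ltW/phil//|/ltW/phir//].
    case=> [//|n]; apply: (iter_derivable_ext dphi).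
    rewrite (_ : g = fun x => bump k s t x + (- r) * psi x); last first.
      by apply/funext => x; rewrite mulNr.
    apply: iter_derivableD; first exact: iter_derivable_bump.
    apply: iter_derivableM; first exact: iter_derivable_cst.
    exact: iter_derivable_bump.
  have := z0 _ tphi.
  have -> : derive1 phi = g.
    by apply/funext => x; rewrite derive1E; have [] := dphi x.
  have izb k' s' t' : mu.-integrable D (EFin \o (fun x => z x * bump k' s' t' x)).
    exact: integrable_mul_continuous.
  have -> : \int[mu]_(x in D) (z x * g x) =
    \int[mu]_(x in D) (z x * bump k s t x) - r * \int[mu]_(x in D) (z x * psi x).
    have -> : (fun x => z x * g x) =
      (fun x => z x * bump k s t x - r * (z x * psi x)).
      by apply/funext => x; rewrite /g; ring.
    rewrite RintegralB//; last exact: (integrableZl _ r (izb 0 s0 t0)).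
    by rewrite RintegralZl//; exact: izb.
  move=> /eqP; rewrite subr_eq0 => /eqP ->.
  by rewrite /r /C mulrAC [RHS]mulrAC; congr (_ / _); exact: mulrC.
have intzC : mu.-integrable D (EFin \o (fun x => z x - C)).
  have iC : mu.-integrable D (EFin \o (fun=> C)).
    by apply: continuous_integrable_itv => x; exact: cvg_cst.
  by have := @integrableB _ _ _ mu D (measurable_itv _) _ _ intz iC.
have zC s t : a < s -> t < b -> \int[mu]_(x in `]s, t[) (z x - C) = 0.
  move=> sa tb.
  have ist : mu.-integrable `]s, t[ (EFin \o (fun x => z x - C)).
    apply: integrableS intzC => //.
    by apply: subset_itv; rewrite bnd_simp ltW.
  have zCb k : (\int[mu]_(x in D) ((z x - C) * bump k s t x)%:E = 0)%E.
    rewrite EFin_Rintegral//; last exact: integrable_mul_continuous.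
    congr EFin.
    have -> : (fun x => (z x - C) * bump k s t x) =
        (fun x => z x * bump k s t x - C * bump k s t x).
      by apply/funext => x; rewrite mulrBl.
    rewrite RintegralB//; last 2 first.
    - exact: integrable_mul_continuous.
    - exact: (integrableZl _ C (ibump k s t)).
    by rewrite zbump// RintegralZl ?subrr//; exact: ibump.
  have [] : [/\ mu.-integrable D
        (fun x => ((z x - C) * (\1_(`]s, t[%classic) x))%:E),
      (\int[mu]_(x in D) `|((z x - C) * bump k s t x)%:E -
          ((z x - C) * (\1_(`]s, t[%classic) x))%:E|)%E
         @[k --> \oo] --> 0%E &
      (\int[mu]_(x in D) ((z x - C) * bump k s t x)%:E)%E @[k --> \oo] -->
      (\int[mu]_(x in D) ((z x - C) * (\1_(`]s, t[%classic) x))%:E)%E].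
    have mzC : measurable_fun D (fun x => z x - C).
      by apply/measurable_EFinP; exact: measurable_int intzC.
    apply: (@dominated_convergence _ _ _ mu D _ _ _
      (fun x => `|(z x - C)%:E|%E)) => //.
    - move=> k; apply/measurable_EFinP; apply: measurable_funM => //.
      by apply: continuous_measurable => //; exact: cbump.
    - apply/measurable_EFinP; apply: measurable_funM => //.
    - apply: aeW => x _; apply: cvg_EFin; first by near=> k.
      by apply: cvgM; [exact: cvg_cst|exact: cvg_bump].
    - exact: integrable_abse intzC.
    - apply: aeW => x k _; rewrite /= lee_fin normrM.
      by rewrite ler_piMr// ger0_norm ?bump_ge0 ?bump_le1.
  move=> _ _; under eq_fun do rewrite zCb.
  move=> cv0.
  have E0 := cvg_unique (@ereal_hausdorff R) cv0 (cvg_cst 0%E).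
  rewrite /Rintegral.
  suff -> : (\int[mu]_(x in `]s, t[) (z x - C)%:E = 0)%E by [].
  rewrite -[RHS]E0.
  rewrite integral_mkcond [RHS]integral_mkcond; apply: eq_integral => x _.
  rewrite !patchE indicE.
  case: (boolP (x \in `]s, t[%classic)) => xst.
    rewrite mem_set ?mulr1//.
    move: xst; rewrite inE/= !in_itv/= => /andP[? ?].
    by rewrite (lt_trans sa)// (lt_trans _ tb).
  by rewrite mulr0; case: ifPn.
exists C.
(* Extension by [0] to the whole line, where Lebesgue differentiation applies: the primitive of [w]
   is constant on []a, b[] by [zC], so its derivative [w] vanishes almost everywhere there. *)
pose w := (fun x => z x - C) \_ D.
have intw : mu.-integrable setT (EFin \o w).
  by rewrite -restrict_EFin; apply: (integrable_mkcond _ _).1.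
have := @FTC1Ny R w; move=> /(_ _ _)/=.
have intwy y : mu.-integrable `]-oo, y] (EFin \o w).
  exact: integrableS intw.
have locw : locally_integrable [set: R] w.
  exact: open_integrable_locally openT intw.
move=> /(_ intwy locw).
apply: filterS; first exact: (ae_filter_ringOfSetsType mu).
move=> x [dF Fw] xD.
have := xD; rewrite inE/= in_itv/= => /andP[ax xb].
apply/eqP; rewrite -subr_eq0; apply/eqP.
have -> : z x - C = w x by rewrite /w patchE xD.
rewrite -Fw derive1E.
pose F (y : R) : R := \int[mu]_(t in `]-oo, y]) w t.
suff -> : 'D_1 F x = 'D_1 (fun=> F x) x by exact: derive_cst.
have Fcst s t : a < s -> s <= t -> t < b -> F t = F s.
  move=> sa st tb; apply/eqP; rewrite -subr_eq0; apply/eqP.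
  rewrite /F Rintegral_itvB// -Rintegral_itv_bndo_bndc; last first.
    exact: integrableS intw.
  rewrite -(zC s t sa tb); apply: eq_Rintegral => y.
  rewrite inE/= in_itv/= => /andP[sy yt]; rewrite /w patchE mem_set//= in_itv/=.
  by rewrite (lt_trans sa)// (lt_trans _ tb).
apply: near_eq_derive; near=> y.
have ay : a < y by near: y; exact: lt_nbhsr.
have yb : y < b by near: y; exact: lt_nbhsl.
by have [/Fcst|/ltW/Fcst] := leP x y => [->//|<-//].
Unshelve. all: by end_near.
Qed.

End primitives_of_pairs.

(** * Absence of contact *)

(** Increments on one side suffice: a derivative above [- k] would keep all nearby difference
    quotients above [- k], which a single small negative increment contradicts. *)
Lemma derive_ge_of_left_bound {R : realType} (f : R -> R) (s k e : R) : 0 < e ->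
  derivable f s 1 -> (forall y, s - e < y < s -> k * (s - y) <= f y - f s) ->
  derive1 f s <= - k.
Proof.
move=> e0 df fk; rewrite leNgt; apply/negP => dk.
have cv : h^-1 *: (f (h *: (1:R) + s) - f s) @[h --> 0^'] --> derive1 f s.
  by rewrite derive1E; exact: df.
have [r /= r0 H] : \forall h \near (0:R)^',
    - k < h^-1 *: (f (h *: (1:R) + s) - f s).
  exact: (cvgr_gt _ cv).
have [m [m0 me mr]] : exists m : R, [/\ 0 < m, m <= e & m <= r].
  by exists (Num.min e r); rewrite lt_min e0 r0 !ge_min !lexx orbT.
pose h := - (m / 2).
have h0 : h < 0 by rewrite /h; lra.
have hr : ball_ Num.norm 0 r h.
  by rewrite /= sub0r opprK gtr0_norm; lra.
have := H _ hr; rewrite /= lt_eqF// => /(_ isT).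
rewrite /GRing.scale/= mulr1 => dkh.
have := fk (h + s); have -> : s - e < h + s < s.
  by rewrite /h; apply/andP; split; lra.
move=> /(_ isT) K.
have : h * (h^-1 * (f (h + s) - f s)) < h * (- k) by rewrite ltr_nM2l.
rewrite mulVKf ?lt_eqF// => K2.
have : k * (s - (h + s)) = h * (- k) by ring.
by move=> K3; lra.
Qed.

Lemma derive_le_of_right_bound {R : realType} (f : R -> R) (s k e : R) : 0 < e ->
  derivable f s 1 -> (forall y, s < y < s + e -> - k * (y - s) <= f y - f s) ->
  - k <= derive1 f s.
Proof.
move=> e0 df fk; rewrite leNgt; apply/negP => dk.
have cv : h^-1 *: (f (h *: (1:R) + s) - f s) @[h --> 0^'] --> derive1 f s.
  by rewrite derive1E; exact: df.
have [r /= r0 H] : \forall h \near (0:R)^',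
    h^-1 *: (f (h *: (1:R) + s) - f s) < - k.
  exact: (cvgr_lt _ cv).
have [m [m0 me mr]] : exists m : R, [/\ 0 < m, m <= e & m <= r].
  by exists (Num.min e r); rewrite lt_min e0 r0 !ge_min !lexx orbT.
pose h := m / 2.
have h0 : 0 < h by rewrite /h; lra.
have hr : ball_ Num.norm 0 r h.
  by rewrite /= sub0r normrN gtr0_norm// /h; lra.
have := H _ hr; rewrite /= gt_eqF// => /(_ isT).
rewrite /GRing.scale/= mulr1 => dkh.
have := fk (h + s); have -> : s < h + s < s + e.
  by rewrite /h; apply/andP; split; lra.
move=> /(_ isT) K.
have : h * (h^-1 * (f (h + s) - f s)) < h * (- k) by rewrite ltr_pM2l.
rewrite mulVKf ?gt_eqF// => K2.
have : - k * ((h + s) - s) = h * (- k) by ring.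
by move=> K3; lra.
Qed.

Section no_contact.
Context {R : realType}.
Variables (a b M K : R) (G v alpha : R -> R).
Hypothesis K0 : 0 <= K.
Hypothesis M0 : 0 <= M.
Hypothesis vK : forall x, `|v x| <= K.
Hypothesis G_le : forall x y k, a <= x -> x <= y -> y <= b ->
  (forall z, x < z < y -> v z <= k) -> G y - G x <= (k + M) * (y - x).
Hypothesis G_ge : forall x y k, a <= x -> x <= y -> y <= b ->
  (forall z, x < z < y -> k <= v z) -> (k - M) * (y - x) <= G y - G x.
Hypotheses (Ga : G a = 0) (Gb : G b = 0).
Hypothesis Galpha : forall x, a < x < b -> G x <= alpha x.
Hypothesis alpha0 : forall x, a < x < b -> 0 < alpha x.
Hypothesis v_homo : forall x y, a < x -> x <= y -> y < b ->
  (forall z, x < z <= y -> G z != - alpha z) -> v x <= v y.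

(** The relation [G' = v - f] enters only through the slope bounds [G_le] and [G_ge]. The crude
    bound [K] on [v] serves for continuity of [G]; the sharp slope comes later. *)
Let G_lip x y : a <= x -> x <= y -> y <= b -> `|G y - G x| <= (K + M) * (y - x).
Proof.
move=> ax xy yb; rewrite ler_norml; apply/andP; split.
  rewrite -mulNr opprD; apply: G_ge => // z _.
  by have := vK z; rewrite ler_norml => /andP[].
apply: G_le => // z _.
by have := vK z; rewrite ler_norml => /andP[].
Qed.

Let v_homo_pos x y : a < x -> x <= y -> y < b ->
  (forall z, x < z <= y -> 0 < G z) -> v x <= v y.
Proof.
move=> ax xy yb G0; apply: v_homo => // z xzy.
have /andP[xz zy] := xzy.
have az : a < z < b by rewrite (lt_trans ax)//= (le_lt_trans zy).
by rewrite gt_eqF// (lt_trans _ (G0 z xzy))// oppr_lt0 alpha0.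
Qed.

(** Let [q] be the first point after [x0] where [G] is nonpositive; it exists since [G b = 0]. If
    [v x0 > M], then [v >= v x0 > M] on []x0, q[], so [G] increases from [G x0 > 0] to [G q <= 0], a
    contradiction. *)
Let v_le x0 : a < x0 < b -> 0 < G x0 -> v x0 <= M.
Proof.
move=> /andP[ax0 x0b] G0; rewrite leNgt; apply/negP => Mv.
pose E := [set y | x0 <= y <= b /\ G y <= 0].
have Eb : E b by rewrite /E/= (ltW x0b) lexx Gb.
have lbE : has_lbound E by exists x0 => y [/andP[]].
have infE : has_inf E by split => //; exists b.
pose q := inf E.
have x0q : x0 <= q by apply: lb_le_inf; [exists b|move=> y [/andP[]]].
have qb : q <= b by exact: ge_inf.
have Gq : G q <= 0.
  rewrite leNgt; apply/negP => Gq0.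
  (* By the Lipschitz bound, [G q > 0] would persist over the length [G q / (K + M + 1)]; the [1]
     keeps the divisor positive when [K = M = 0]. *)
  have KM : 0 < K + M + 1 by rewrite ltr_wpDl ?addr_ge0.
  have e0 : 0 < G q / (K + M + 1) by rewrite divr_gt0.
  have [y [/andP[x0y yb] Gy] yq] := inf_adherent e0 infE.
  have qy : q <= y by apply: ge_inf => //; split=> //; rewrite x0y.
  have := G_lip (le_trans (ltW ax0) x0q) qy yb; rewrite ler_norml => /andP[h _].
  have : y - q < G q / (K + M + 1) by rewrite ltrBlDl.
  rewrite ltr_pdivlMr// => h2.
  have : 0 <= y - q by rewrite subr_ge0.
  by nra.
have x0q' : x0 < q.
  rewrite lt_neqAle x0q andbT; apply/eqP => x0q1.
  by move: Gq; rewrite -x0q1 leNgt G0.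
have Gpos z : x0 <= z -> z < q -> 0 < G z.
  move=> x0z zq; rewrite ltNge; apply/negP => Gz.
  have : q <= z.
    by apply: ge_inf => //; split=> //; rewrite x0z (le_trans (ltW zq)).
  by rewrite leNgt zq.
have := @G_ge x0 q (v x0) (ltW ax0) x0q qb.
have H : forall z, x0 < z < q -> v x0 <= v z.
  move=> z /andP[xz zq]; apply: v_homo_pos; rewrite ?(ltW xz)//.
    exact: lt_le_trans qb.
  move=> y /andP[xy yz]; apply: Gpos; first exact: ltW.
  exact: le_lt_trans zq.
move=> /(_ H) h.
have : 0 < (v x0 - M) * (q - x0) by rewrite mulr_gt0// subr_gt0.
lra.
Qed.

(** The argument runs to the left: [p] is the last point before [x0] with [G] nonpositive, and
    monotonicity gives [v <= v x0 < - M] on []p, x0[], so [G] would decrease from [p] to [x0]. *)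
Let v_ge x0 : a < x0 < b -> 0 < G x0 -> - M <= v x0.
Proof.
move=> /andP[ax0 x0b] G0; rewrite leNgt; apply/negP => Mv.
pose E := [set y | a <= y <= x0 /\ G y <= 0].
have Ea : E a by rewrite /E/= (ltW ax0) lexx Ga.
have ubE : has_ubound E by exists x0 => y [/andP[]].
have supE : has_sup E by split => //; exists a.
pose p := sup E.
have px0 : p <= x0 by apply: sup_le_ub; [exists a|move=> y [/andP[]]].
have ap : a <= p by exact: ub_le_sup.
have Gp : G p <= 0.
  rewrite leNgt; apply/negP => Gp0.
  have KM : 0 < K + M + 1 by rewrite ltr_wpDl ?addr_ge0.
  have e0 : 0 < G p / (K + M + 1) by rewrite divr_gt0.
  have [y [/andP[ay yx0] Gy] yp] := sup_adherent e0 supE.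
  have py : y <= p by apply: ub_le_sup => //; split=> //; rewrite ay.
  have := G_lip ay py (le_trans px0 (ltW x0b)); rewrite ler_norml => /andP[_ h].
  have : p - y < G p / (K + M + 1) by rewrite ltrBlDr -ltrBlDl.
  rewrite ltr_pdivlMr// => h2.
  have : 0 <= p - y by rewrite subr_ge0.
  by nra.
have px0' : p < x0.
  rewrite lt_neqAle px0 andbT; apply/eqP => px1.
  by move: Gp; rewrite px1 leNgt G0.
have Gpos z : p < z -> z <= x0 -> 0 < G z.
  move=> pz zx0; rewrite ltNge; apply/negP => Gz.
  have : z <= p.
    by apply: ub_le_sup => //; split=> //; rewrite zx0 (le_trans ap (ltW pz)).
  by rewrite leNgt pz.
have := @G_le p x0 (v x0) ap px0 (ltW x0b).
have H : forall z, p < z < x0 -> v z <= v x0.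
  move=> z /andP[pz zx]; apply: v_homo_pos; rewrite ?(ltW zx)//.
    exact: le_lt_trans pz.
  move=> y /andP[zy yx]; apply: Gpos => //.
  exact: lt_trans zy.
move=> /(_ H) h.
have : (v x0 + M) * (x0 - p) < 0 by rewrite nmulr_rlt0 ?subr_gt0//; lra.
lra.
Qed.

(** At a contact point [alpha y - alpha s >= G y - G s]. Increments to the right then give
    [alpha' s >= - 2 M], and increments to the left give [alpha' s <= 2 M]. *)
Lemma no_contact s : a < s < b -> derivable alpha s 1 ->
  2 * M < `|derive1 alpha s| -> G s != alpha s.
Proof.
move=> sab da dM; apply/eqP => Gs.
have /andP[as_ sb] := sab.
have Gs0 : 0 < G s by rewrite Gs alpha0.
have KM : 0 < K + M + 1 by rewrite ltr_wpDl ?addr_ge0.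
have d0 : 0 < G s / (K + M + 1) by rewrite divr_gt0.
(* The radius keeps the neighbourhood inside []a, b[] and, by the Lipschitz bound, [G] positive on
   it. *)
have [e [e0 ea eb ed]] : exists e, [/\ 0 < e, e <= s - a, e <= b - s &
    e <= G s / (K + M + 1)].
  exists (Num.min (s - a) (Num.min (b - s) (G s / (K + M + 1)))).
  rewrite !lt_min !subr_gt0 as_ sb d0; split=> //; rewrite !ge_min !lexx ?orbT//.
rewrite ler_pdivlMr// in ed.
have vM z : s - e < z < s + e -> - M <= v z <= M.
  move=> /andP[zl zr].
  have zab : a < z < b by apply/andP; split; lra.
  have Gz : 0 < G z.
    have [sz|/ltW zs] := leP s z.
      have := @G_lip s z (ltW as_) sz (ltac:(lra)).
      rewrite ler_norml => /andP[h _].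
      by nra.
    have := @G_lip z s (ltac:(lra)) zs (ltW sb).
    rewrite ler_norml => /andP[_ h].
    by nra.
  by rewrite v_ge// v_le.
move: dM; apply/negP; rewrite -leNgt ler_norml; apply/andP; split.
  apply: (@derive_le_of_right_bound _ _ _ _ e) => // y /andP[sy ye].
  rewrite -Gs; have yab : a < y < b by apply/andP; split; lra.
  have := Galpha yab.
  have h : (- M - M) * (y - s) <= G y - G s.
    apply: G_ge; rewrite ?(ltW sy) ?(ltW as_)//; first lra.
    move=> z /andP[sz zy].
    by have /andP[] : - M <= v z <= M by apply: vM; apply/andP; split; lra.
  have -> : - (2 * M) * (y - s) = (- M - M) * (y - s) by ring.
  by move=> ?; lra.
rewrite -[leRHS]opprK.
apply: (@derive_ge_of_left_bound _ _ _ _ e) => // y /andP[ye ys].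
rewrite -Gs; have yab : a < y < b by apply/andP; split; lra.
have := Galpha yab.
have h : G s - G y <= (M + M) * (s - y).
  apply: G_le; rewrite ?(ltW ys) ?(ltW sb)//; first lra.
  move=> z /andP[yz zs].
  by have /andP[] : - M <= v z <= M by apply: vM; apply/andP; split; lra.
have -> : - (2 * M) * (s - y) = - ((M + M) * (s - y)) by ring.
by move=> ?; lra.
Qed.

End no_contact.

(** * First variation of the energy *)

Lemma ae_eq_EFin_integral {d} {T : measurableType d} {R : realType}
    (m : {measure set T -> \bar R}) (A : set T) (f g : T -> R) :
  measurable A -> measurable_fun A f -> measurable_fun A g ->
  {ae m, forall x, A x -> f x = g x} ->
  (\int[m]_(x in A) (f x)%:E = \int[m]_(x in A) (g x)%:E)%E.
Proof.
move=> mA mf mg fg; apply: ae_eq_integral => //.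
- exact/measurable_EFinP.
- exact/measurable_EFinP.
- by apply: filterS fg => x fgx Ax; rewrite fgx.
Qed.

Section weighted_total_variation.
Context {R : realType} (a b : R).
Local Notation D := `]a, b[%classic.
Local Notation mu := (@lebesgue_measure R).
Implicit Types m n : {finite_measure set R -> \bar R}.
Variable alpha : R -> R.
Hypothesis hab : a < b.
Hypothesis alpha_cont : {within `[a, b], continuous alpha}.
Hypothesis alpha_gt0 : forall x, x \in `[a, b] -> 0 < alpha x.

Lemma measurable_alpha : measurable_fun D alpha.
Proof.
apply: (@measurable_funS _ _ _ _ `[a, b]%classic) => //.
  exact: subset_itv_oo_cc.
exact: subspace_continuous_measurable_fun.
Qed.

Lemma integrable_alpha m : m.-integrable D (EFin \o alpha).
Proof.
have [c cab ca] := EVT_max (ltW hab) alpha_cont.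
apply: (@integrable_le_bound _ _ _ _ _ _ (alpha c)) => //.
- by rewrite -ge0_fin_numE ?measure_ge0// fin_num_measure.
- exact: measurable_alpha.
- move=> x /= xD; have xab := subset_itv_oo_cc xD.
  by rewrite gtr0_norm ?alpha_gt0// ca.
Qed.

Definition weighted_mass m : R := \int[m]_(x in D) alpha x.

Lemma weighted_mass_add m1 m2 :
  weighted_mass (measure_add m1 m2) = weighted_mass m1 + weighted_mass m2.
Proof.
apply: EFin_inj; rewrite EFinD /weighted_mass -!EFin_Rintegral//.
- by rewrite integral_measure_add//; exact: integrable_alpha.
- exact: integrable_alpha.
- exact: integrable_alpha.
- exact: integrable_alpha.
Qed.

Lemma weighted_mass_scale (t : {nonneg R}) m :
  weighted_mass (mscale t m) = t%:num * weighted_mass m.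
Proof.
apply: EFin_inj; rewrite EFinM /weighted_mass -!EFin_Rintegral//.
- rewrite ge0_integral_mscale//.
    by apply/measurable_EFinP; exact: measurable_alpha.
  move=> x /= xD; rewrite lee_fin ltW// alpha_gt0//.
  exact: subset_itv_oo_cc.
- exact: integrable_alpha.
- exact: integrable_alpha.
Qed.

Lemma weighted_mass_dirac s : s \in `]a, b[ -> weighted_mass (\d_s) = alpha s.
Proof.
move=> sD; rewrite /weighted_mass /Rintegral integral_dirac//.
  by rewrite diracE mem_set// mul1e.
by apply/measurable_EFinP; exact: measurable_alpha.
Qed.

Lemma weighted_mass_le m n :
  (forall A, measurable A -> (m A <= n A)%E) ->
  weighted_mass m <= weighted_mass n.
Proof.
move=> mn; rewrite -lee_fin /weighted_mass -!EFin_Rintegral//; last 2 first.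
- exact: integrable_alpha.
- exact: integrable_alpha.
rewrite integral_mkcond [leRHS]integral_mkcond.
apply: ge0_le_measure_integral => //.
  move=> x; rewrite patchE; case: ifPn => //; rewrite inE/= => xD.
  by rewrite lee_fin ltW// alpha_gt0//; exact: subset_itv_oo_cc.
rewrite restrict_EFin; apply/measurable_EFinP.
by apply: (measurable_restrictT _ _).1 => //; exact: measurable_alpha.
Qed.

Lemma integral_abs_derivative v :
  let nu := distributional_derivative a b v in
  (\int[abs_derivative a b v]_(x in D) (alpha x)%:E =
   (weighted_mass (charge_pos nu) + weighted_mass (charge_neg nu))%:E)%E.
Proof.
move=> nu; rewrite -weighted_mass_add /weighted_mass.
rewrite -EFin_Rintegral//; last first.
  exact: integrable_alpha.
apply: eq_measure_integral => A mA _.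
exact: (esym (measure_addE (charge_pos nu) (charge_neg nu) A)).
Qed.

Lemma integral_abs_derivative_le v n1 n2 :
  mu.-integrable D (EFin \o v) -> derivative_pair a b v n1 n2 ->
  (\int[abs_derivative a b v]_(x in D) (alpha x)%:E <=
   (weighted_mass n1 + weighted_mass n2)%:E)%E.
Proof.
move=> intv vn; rewrite integral_abs_derivative lee_fin.
have le12 := charge_pos_neg_le intv vn (distributional_derivative_pair intv vn).
by apply: lerD; apply: weighted_mass_le => A /le12[].
Qed.

Lemma bounded_integrable_itv (g : R -> R) (K : R) : measurable_fun D g ->
  (forall x, D x -> `|g x| <= K) -> mu.-integrable D (EFin \o g).
Proof.
move=> mg gK; have muD : (mu D < +oo)%E.
  by rewrite lebesgue_measure_itv/= lte_fin hab -EFinB ltry.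
exact: integrable_le_bound muD mg gK.
Qed.

(* [q] is a bounded representative of [f - u]; the energy of [u + t h] is expanded
   to second order in [t], and [t] tends to [0]. *)
Lemma first_variation (f u q h : R -> R) (K beta : R) :
  measurable_fun D f ->
  measurable_fun D q -> (forall x, D x -> `|q x| <= K) ->
  {ae mu, forall x, D x -> f x - u x = q x} ->
  measurable_fun D h -> (forall x, D x -> `|h x| <= K) ->
  weighted_TV_solution a b alpha f u ->
  let nu := distributional_derivative a b u in
  (forall t, 0 < t <= 1 -> exists n1 n2,
    derivative_pair a b (fun x => u x + t * h x) n1 n2 /\
    weighted_mass n1 + weighted_mass n2 <=
    weighted_mass (charge_pos nu) + weighted_mass (charge_neg nu) + t * beta) ->
  \int[mu]_(x in D) (q x * h x) <= beta.
Proof.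
move=> mf mq qK fuq mh hK [[intu _] umin] nu var.
have mu_ : measurable_fun D u.
  by apply/measurable_EFinP; exact: measurable_int intu.
have inth := bounded_integrable_itv mh hK.
have K2 (g1 g2 : R -> R) x : (forall x, D x -> `|g1 x| <= K) ->
    (forall x, D x -> `|g2 x| <= K) -> D x -> `|g1 x * g2 x| <= K * K.
  by move=> g1K g2K Dx; rewrite normrM ler_pM ?g1K ?g2K.
have intqq : mu.-integrable D (EFin \o (fun x => q x * q x)).
  apply: bounded_integrable_itv; first exact: measurable_funM.
  by move=> x; exact: K2.
have intqh : mu.-integrable D (EFin \o (fun x => q x * h x)).
  apply: bounded_integrable_itv; first exact: measurable_funM.
  by move=> x; exact: K2.
have inthh : mu.-integrable D (EFin \o (fun x => h x * h x)).
  apply: bounded_integrable_itv; first exact: measurable_funM.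
  by move=> x; exact: K2.
pose Q := \int[mu]_(x in D) (q x * q x).
pose L := \int[mu]_(x in D) (q x * h x).
pose H := \int[mu]_(x in D) (h x * h x).
have quad t :
    (\int[mu]_(x in D) ((f x - (u x + t * h x)) ^+ 2)%:E =
    (Q - (2 * t) * L + t ^+ 2 * H)%:E)%E.
  rewrite (@ae_eq_EFin_integral _ _ _ mu D _
    (fun x => (q x * q x - (2 * t) * (q x * h x)) + t ^+ 2 * (h x * h x)))//.
  - rewrite EFin_Rintegral//.
      congr EFin; rewrite RintegralD//.
      + rewrite RintegralB//; last exact: (integrableZl _ _ intqh).
        by rewrite !RintegralZl.
      + by apply: (integrableB _ intqq (integrableZl _ _ intqh)).
      + exact: (integrableZl _ _ inthh).
    exact: (integrableD _ (integrableB _ intqq (integrableZl _ _ intqh))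
      (integrableZl _ _ inthh)).
  - apply: measurable_funX; apply: measurable_funB => //.
    by apply: measurable_funD => //; apply: measurable_funM.
  - apply: measurable_funD; last by apply: measurable_funM => //; exact: measurable_funM.
    apply: measurable_funB; first exact: measurable_funM.
    by apply: measurable_funM => //; exact: measurable_funM.
  - move: fuq; apply: filterS; first exact: (ae_filter_ringOfSetsType mu).
    by move=> x /[apply] fux; rewrite -fux; ring.
have ineq t : 0 < t <= 1 -> L <= beta + t / 2 * H.
  move=> t01; have [n1 [n2 [vn le12]]] := var t t01.
  have intv : mu.-integrable D (EFin \o (fun x => u x + t * h x)).
    exact: (integrableD _ intu (integrableZl _ _ inth)).
  have BVv : BV a b (fun x => u x + t * h x).
    split=> //; exists (charge_of_pair n1 n2).
    exact: derivative_pair_is_distributional.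
  have := umin _ BVv; rewrite /weighted_TV_energy quad.
  (* At [t = 0] the expansion is the fidelity term of [u]. Subtracting the energies leaves terms
     with a factor [t], which is then divided out. *)
  have := quad 0.
  have -> : (fun x => ((f x - (u x + 0 * h x)) ^+ 2)%:E) =
            (fun x => ((f x - u x) ^+ 2)%:E).
    by apply/funext => x; rewrite mul0r addr0.
  move=> ->; rewrite integral_abs_derivative => h1.
  have := le_trans h1 (leeD2l _ (integral_abs_derivative_le intv vn)).
  rewrite -!EFinM -!EFinD lee_fin -/nu => h2.
  have t0 : 0 < t by case/andP: t01.
  rewrite -(ler_pM2l t0); nra.
rewrite leNgt; apply/negP => Lb.
have H0 : 0 <= H by apply: Rintegral_ge0 => x _; rewrite -expr2 sqr_ge0.
(* For such [t] the error [t / 2 * H] is too small to fill the gap [L - beta]; [H + 1] avoids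
   dividing by zero. *)
have [t [t0 t1 tH]] : exists t, [/\ 0 < t, t <= 1 & t * (H + 1) <= L - beta].
  exists (Num.min 1 ((L - beta) / (H + 1))).
  have H1 : 0 < H + 1 by lra.
  rewrite lt_min ltr01 divr_gt0 ?subr_gt0//; split=> //; first by rewrite ge_min lexx.
  by rewrite -ler_pdivlMr// ge_min lexx orbT.
have := ineq t; rewrite t0 t1 => /(_ isT) Lt.
have : 0 <= t * H by rewrite mulr_ge0// ltW.
by rewrite -/L in Lb; nra.
Qed.

End weighted_total_variation.

(** * Perturbations of the derivative *)

Section pair_operations.
Context {R : realType} (a b : R).
Local Notation D := `]a, b[%classic.
Local Notation mu := (@lebesgue_measure R).
Implicit Types m n : {finite_measure set R -> \bar R}.

Lemma Rintegral_mscale (t : {nonneg R}) m (f : R -> R) : continuous f ->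
  \int[mscale t m]_(x in D) f x = t%:num * \int[m]_(x in D) f x.
Proof.
move=> cf.
have mf : measurable_fun D (EFin \o f).
  by apply/measurable_EFinP; exact: continuous_measurable.
have intf := continuous_integrable a b m cf.
have intft := continuous_integrable a b (mscale t m) cf.
apply: EFin_inj; rewrite EFinM -!EFin_Rintegral//.
rewrite integralE [X in (_ * X)%E]integralE.
rewrite !ge0_integral_mscale//; try exact: measurable_funepos;
  try exact: measurable_funeneg.
by rewrite [RHS]muleBr//; apply: integrable_add_def.
Qed.

Lemma carried_mscale (t : {nonneg R}) m :
  carried a b m -> carried a b (mscale t m).
Proof.
move=> cm A mA.
change ((t%:num)%:E * m A = (t%:num)%:E * m (A `&` D))%E.
by rewrite -cm.
Qed.

Lemma carried_measure_add m1 m2 : carried a b m1 -> carried a b m2 ->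
  carried a b (measure_add m1 m2).
Proof.
move=> c1 c2 A mA; rewrite /= !measure_addE.
change (m1 A + m2 A = m1 (A `&` D) + m2 (A `&` D))%E.
by rewrite -c1// -c2.
Qed.

Lemma carried_dirac s : s \in `]a, b[ -> carried a b (\d_s).
Proof.
move=> sD A mA; rewrite /= !diracE; congr (_%:R%:E); congr nat_of_bool.
by rewrite in_setI [X in _ && X]mem_set// andbT.
Qed.

Lemma Rintegral_dirac s (f : R -> R) : s \in `]a, b[ -> measurable_fun D f ->
  \int[\d_s]_(x in D) f x = f s.
Proof.
move=> sD mf; rewrite /Rintegral integral_dirac//; last exact/measurable_EFinP.
by rewrite diracE mem_set// mul1e.
Qed.

Lemma Rintegral_derive_test phi : a < b -> test_function a b phi ->
  \int[mu]_(x in D) derive1 phi x = 0.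
Proof.
move=> ab tphi.
rewrite (Rintegral_derive (ltW ab) (test_function_is_derive tphi)).
  by rewrite !(test_function_out tphi) ?subrr// in_itv/= ltxx ?andbF.
exact: test_function_derive_continuous tphi.
Qed.

Lemma Rintegral_add_scale (u h g : R -> R) t : mu.-integrable D (EFin \o u) ->
  mu.-integrable D (EFin \o h) -> continuous g ->
  \int[mu]_(x in D) ((u x + t * h x) * g x) =
  \int[mu]_(x in D) (u x * g x) + t * \int[mu]_(x in D) (h x * g x).
Proof.
move=> intu inth cg.
have iu := integrable_mul_continuous intu cg.
have ih := integrable_mul_continuous inth cg.
rewrite -RintegralZl// -RintegralD//; last exact: (integrableZl _ t ih).
by apply: eq_Rintegral => x _; ring.
Qed.

Lemma derivative_pair_add_cst (u : R -> R) m1 m2 k : a < b ->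
  mu.-integrable D (EFin \o u) -> derivative_pair a b u m1 m2 ->
  derivative_pair a b (fun x => u x + k) m1 m2.
Proof.
move=> ab intu [c1 c2 dphi]; split=> // phi tphi.
have cphi' := test_function_derive_continuous tphi.
have i1 : mu.-integrable D (EFin \o (fun=> 1 : R)).
  by apply: continuous_integrable_itv => x; exact: cvg_cst.
have -> : (fun x => (u x + k) * derive1 phi x) =
          (fun x => (u x + k * 1) * derive1 phi x).
  by apply/funext => x; rewrite mulr1.
rewrite (Rintegral_add_scale _ intu i1 cphi').
under [X in k * X]eq_Rintegral do rewrite mul1r.
by rewrite Rintegral_derive_test// mulr0 addr0 dphi.
Qed.

(** The contraction uses a second function [w] with the same derivative as [u], because the
    direction of variation must be bounded everywhere; [w] will be the good representative. *)
Lemma derivative_pair_scale (u w : R -> R) m1 m2 (t : {nonneg R}) (s : R) :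
  t%:num = 1 - s ->
  mu.-integrable D (EFin \o u) -> mu.-integrable D (EFin \o w) ->
  derivative_pair a b u m1 m2 -> derivative_pair a b w m1 m2 ->
  derivative_pair a b (fun x => u x + s * - w x) (mscale t m1) (mscale t m2).
Proof.
move=> ts intu intw [c1 c2 du] [_ _ dw]; split; try exact: carried_mscale.
move=> phi tphi; have cphi := test_function_continuous tphi.
have cphi' := test_function_derive_continuous tphi.
have -> : (fun x => (u x + s * - w x) * derive1 phi x) =
          (fun x => (u x + (- s) * w x) * derive1 phi x).
  by apply/funext => x; ring.
rewrite (Rintegral_add_scale _ intu intw cphi') du// dw// !Rintegral_mscale// ts.
ring.
Qed.

Lemma derivative_pair_add_cdf (u : R -> R) m1 m2 n (t : {nonneg R}) :
  mu.-integrable D (EFin \o u) -> carried a b n ->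
  derivative_pair a b u m1 m2 ->
  derivative_pair a b (fun x => u x + t%:num * cdf_from a n x)
    (measure_add m1 (mscale t n)) m2.
Proof.
move=> intu cn [c1 c2 du]; split=> //.
  by apply: carried_measure_add => //; exact: carried_mscale.
move=> phi tphi; have cphi := test_function_continuous tphi.
have cphi' := test_function_derive_continuous tphi.
rewrite (Rintegral_add_scale _ intu (integrable_cdf_from a b n) cphi').
rewrite cdf_from_test// du// Rintegral_measure_add// Rintegral_mscale//.
ring.
Qed.

Lemma derivative_pair_sub_cdf (u : R -> R) m1 m2 n (t : {nonneg R}) :
  mu.-integrable D (EFin \o u) -> carried a b n ->
  derivative_pair a b u m1 m2 ->
  derivative_pair a b (fun x => u x + t%:num * - cdf_from a n x)
    m1 (measure_add m2 (mscale t n)).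
Proof.
move=> intu cn [c1 c2 du]; split=> //.
  by apply: carried_measure_add => //; exact: carried_mscale.
move=> phi tphi; have cphi := test_function_continuous tphi.
have cphi' := test_function_derive_continuous tphi.
have -> : (fun x => (u x + t%:num * - cdf_from a n x) * derive1 phi x) =
          (fun x => (u x + (- t%:num) * cdf_from a n x) * derive1 phi x).
  by apply/funext => x; ring.
rewrite (Rintegral_add_scale _ intu (integrable_cdf_from a b n) cphi').
rewrite cdf_from_test// du// Rintegral_measure_add// Rintegral_mscale//.
ring.
Qed.

Lemma norm_Linfty_ae (f : R -> R) : a < b -> (norm_Linfty a b f < +oo)%E ->
  exists M, [/\ 0 <= M, norm_Linfty a b f = M%:E &
    {ae mu, forall x, D x -> `|f x| <= M}].
Proof.
move=> ab Nfin.
have N0 : (0 <= norm_Linfty a b f)%E by exact: Lnorm_ge0.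
have NE : norm_Linfty a b f = (fine (norm_Linfty a b f))%:E.
  by rewrite fineK// ge0_fin_numE.
exists (fine (norm_Linfty a b f)); split=> //; first exact: fine_ge0.
(* The norm of exponent [+oo] unfolds to an essential supremum only when the space has positive
   measure. *)
have muD : (0 < mrestr mu (measurable_itv `]a, b[) setT)%E.
  rewrite /mrestr setTI lebesgue_measure_itv/= lte_fin ab -EFinB lte_fin.
  by rewrite subr_gt0.
move: NE; rewrite {1}/norm_Linfty unlock /Lnorm muD => NE.
have [N [mN N0' sN]] := ess_sup_ge (mrestr mu (measurable_itv `]a, b[))
  (abse \o (EFin \o f)).
exists (N `&` D); split; [exact: measurableI|exact: N0'|].
move=> x /= /not_implyP[xD fx]; split=> //; apply: sN => /=.
by rewrite NE lee_fin; exact: fx.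
Qed.

(** An explicit measurable null set is produced, so that any measurable set on which [g] never
    vanishes gets measure zero by monotonicity. *)
Lemma Rintegral_eq0_ge0 m (g : R -> R) : m.-integrable D (EFin \o g) ->
  (forall x, D x -> 0 <= g x) -> \int[m]_(x in D) g x <= 0 ->
  exists N, [/\ measurable N, m N = 0%E & forall x, D x -> g x != 0 -> N x].
Proof.
move=> intg g0 Ig.
have I0 : \int[m]_(x in D) g x = 0.
  by apply/eqP; rewrite eq_le Ig Rintegral_ge0.
have : (\int[m]_(x in D) `|(g x)%:E| = 0)%E.
  rewrite (eq_integral (EFin \o g)).
    by rewrite EFin_Rintegral// I0.
  by move=> x; rewrite inE => xD; rewrite gee0_abs// lee_fin g0.
have mg : measurable_fun D (EFin \o g) := measurable_int m intg.
move=> /(ae_eq_integral_abs m (measurable_itv _) mg).1 [N [mN N0 sN]].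
exists N; split=> // x xD gx; apply: sN => /= /(_ xD) [].
by move/eqP: gx.
Qed.

Lemma tailB (q : R -> R) x y : mu.-integrable D (EFin \o q) ->
  a <= x -> x <= y -> y <= b ->
  tail_integral b q x - tail_integral b q y = \int[mu]_(z in `]x, y[) q z.
Proof.
move=> intq ax xy; rewrite le_eqVlt => /orP[/eqP ->|yb].
  rewrite {2}/tail_integral set_itv_ge ?bnd_simp ?ltxx// Rintegral_set0 subr0//.
have intx := integrable_tail ax intq.
rewrite /tail_integral [RHS]Rintegral_itv_bndo_bndc; last first.
  apply: integrableS intx => //.
  by apply: subset_itvl; rewrite bnd_simp ltW.
apply/eqP; rewrite subr_eq addrC -subr_eq; apply/eqP.
by rewrite Rintegral_itvB// bnd_simp.
Qed.

End pair_operations.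

(** * Optimality conditions *)

Lemma Rintegral_cst_itv {R : realType} (x y k : R) : x <= y ->
  \int[@lebesgue_measure R]_(z in `]x, y[) (fun=> k) z = k * (y - x).
Proof.
move=> xy; rewrite Rintegral_cst//; congr (k * _).
have E : lebesgue_measure (`]x, y[%classic : set R) = (y - x)%:E.
  rewrite lebesgue_measure_itv/= lte_fin.
  move: xy; rewrite le_eqVlt => /orP[/eqP ->|->]; last by rewrite -EFinB.
  by rewrite ltxx subrr.
exact: (congr1 fine E).
Qed.

Lemma Rintegral_ge_cst {R : realType} (g : R -> R) (x y k : R) : x <= y ->
  (@lebesgue_measure R).-integrable `]x, y[ (EFin \o g) ->
  (forall z, x < z < y -> k <= g z) ->
  k * (y - x) <= \int[@lebesgue_measure R]_(z in `]x, y[) g z.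
Proof.
move=> xy intg kg; rewrite -Rintegral_cst_itv//; apply: le_Rintegral => //.
by apply: continuous_integrable_itv => z; exact: cvg_cst.
Qed.

Lemma Rintegral_le_cst {R : realType} (g : R -> R) (x y k : R) : x <= y ->
  (@lebesgue_measure R).-integrable `]x, y[ (EFin \o g) ->
  (forall z, x < z < y -> g z <= k) ->
  \int[@lebesgue_measure R]_(z in `]x, y[) g z <= k * (y - x).
Proof.
move=> xy intg kg; rewrite -Rintegral_cst_itv//; apply: le_Rintegral => //.
by apply: continuous_integrable_itv => z; exact: cvg_cst.
Qed.

Section optimality.
Context {R : realType} (a b : R).
Local Notation D := `]a, b[%classic.
Local Notation mu := (@lebesgue_measure R).
Variables alpha f u : R -> R.
Variable M : R.
Hypothesis hab : a < b.
Hypothesis alpha_cont : {within `[a, b], continuous alpha}.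
Hypothesis alpha_gt0 : forall x, x \in `[a, b] -> 0 < alpha x.
Hypothesis mf : measurable_fun D f.
Hypothesis M0 : 0 <= M.
Hypothesis fM : {ae mu, forall x, D x -> `|f x| <= M}.
Hypothesis hu : weighted_TV_solution a b alpha f u.

Let nu := distributional_derivative a b u.
Let m1 := charge_pos nu.
Let m2 := charge_neg nu.

Let intu : mu.-integrable D (EFin \o u). Proof. by have [[]] := hu. Qed.

Let u_pair : derivative_pair a b u m1 m2.
Proof.
apply: derivative_pair_jordan => //; have [[_ ex] _] := hu.
rewrite /nu /distributional_derivative; case: pselect => // e.
exact: projT2 (cid e).
Qed.

(** By [cdf_pair] the difference of the distribution functions has the same derivative as [u], so du
    Bois-Reymond applies to what remains after subtracting it. *)
Lemma good_representative : exists C,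
  {ae mu, forall x, D x -> u x = C + (cdf_from a m1 x - cdf_from a m2 x)}.
Proof.
have [c1 c2 du] := u_pair.
have i1 := integrable_cdf_from a b m1.
have i2 := integrable_cdf_from a b m2.
pose z x := u x + (-1) * (cdf_from a m1 x - cdf_from a m2 x).
have iw : mu.-integrable D (EFin \o (fun x => cdf_from a m1 x - cdf_from a m2 x)).
  exact: (integrableB _ i1 i2).
have intz : mu.-integrable D (EFin \o z).
  exact: (integrableD _ intu (integrableZl _ (-1) iw)).
have [|C zC] := du_Bois_Reymond hab intz.
  move=> phi tphi.
  rewrite (Rintegral_add_scale _ intu iw (test_function_derive_continuous tphi)).
  have [_ _ dw] := cdf_pair c1 c2.
  by rewrite du// dw//; ring.
exists C; move: zC; apply: filterS; first exact: (ae_filter_ringOfSetsType mu).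
move=> x zx Dx; have : z x = C by apply: zx; rewrite inE.
by rewrite /z => <-; ring.
Qed.

(** Collects what the contact argument needs in pointwise form. The conditions on the parts of [Du]
    appear contrapositively: away from contact with [- alpha] (resp. [alpha]) the negative (resp.
    positive) part vanishes. *)
Lemma solution_optimality : exists (v G : R -> R) (K : R),
  [/\ 0 <= K /\ (forall x, `|v x| <= K),
      (forall x y k, a <= x -> x <= y -> y <= b ->
        (forall z, x < z < y -> v z <= k) -> G y - G x <= (k + M) * (y - x)) /\
      (forall x y k, a <= x -> x <= y -> y <= b ->
        (forall z, x < z < y -> k <= v z) -> (k - M) * (y - x) <= G y - G x),
      G a = 0 /\ G b = 0,
      (forall x, a < x < b -> G x <= alpha x) /\
      (forall x, a < x < b -> - G x <= alpha x) &
      [/\ (forall x y, a < x -> x <= y -> y < b ->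
            (forall z, x < z <= y -> G z != - alpha z) -> v x <= v y),
          (forall x y, a < x -> x <= y -> y < b ->
            (forall z, x < z <= y -> G z != alpha z) -> v y <= v x) &
          forall A, measurable A -> A `<=` D ->
            (forall z, A z -> G z != alpha z /\ G z != - alpha z) ->
            abs_derivative a b u A = 0%E]].
Proof.
have [C uC] := good_representative.
have [c1 c2 du] := u_pair.
have i1 := integrable_cdf_from a b m1.
have i2 := integrable_cdf_from a b m2.
pose v x := C + (cdf_from a m1 x - cdf_from a m2 x).
(* Truncation changes [f] on a null set only, and makes the bound by [M] hold at every point. *)
pose ft x := Num.max (- M) (Num.min M (f x)).
pose q x := ft x - v x.
pose K0 := `|C| + fine (m1 setT) + fine (m2 setT).
have vK0 x : `|v x| <= K0.
  have h1 := cdf_from_ge0 a m1 x; have h2 := cdf_from_ge0 a m2 x.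
  have h3 := cdf_from_le a m1 x; have h4 := cdf_from_le a m2 x.
  have h5 := ler_norm C; have h6 := ler_norm (- C); rewrite normrN in h6.
  by rewrite ler_norml /v /K0; apply/andP; split; have := M0; lra.
have K00 : 0 <= K0 by exact: le_trans (vK0 0).
have ftM x : - M <= ft x <= M.
  by rewrite /ft le_max lexx /= ge_max ge_min lexx /= andbT; have := M0; lra.
(* A single bound for [q] (at most [M + K0]), for [v] and for the Heaviside and constant directions
   (at most [1]). *)
pose K := M + K0 + 1.
have vK x : D x -> `|v x| <= K.
  by move=> _; apply: le_trans (vK0 x) _; rewrite /K; have := M0; lra.
have qK x : D x -> `|q x| <= K.
  move=> _; have /andP[h1 h2] := ftM x; have := vK0 x.
  rewrite ler_norml => /andP[h3 h4].
  by rewrite ler_norml /q /K; apply/andP; split; have := M0; lra.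
have mv : measurable_fun D v.
  apply: measurable_funD => //.
  by apply: measurable_funB => //; exact: measurable_cdf_from.
have mft : measurable_fun D ft.
  apply: measurable_maxr => //; exact: measurable_minr.
have mq : measurable_fun D q by exact: measurable_funB.
have fuq : {ae mu, forall x, D x -> f x - u x = q x}.
  move: fM uC; apply: filterS2; first exact: (ae_filter_ringOfSetsType mu).
  move=> x fx ux Dx; rewrite /q (ux Dx : u x = v x) /ft.
  have := fx Dx; rewrite ler_norml => /andP[h1 h2].
  by rewrite min_r// max_r.
have intq : mu.-integrable D (EFin \o q) := bounded_integrable_itv hab mq qK.
have intv : mu.-integrable D (EFin \o v) := bounded_integrable_itv hab mv vK.
have v_pair : derivative_pair a b v m1 m2.
  have iw : mu.-integrable D
      (EFin \o (fun x => cdf_from a m1 x - cdf_from a m2 x)).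
    exact: (integrableB _ i1 i2).
  have := derivative_pair_add_cst C hab iw (cdf_pair c1 c2).
  by congr derivative_pair; apply/funext => x; rewrite /v addrC.
pose G := tail_integral b q.
have FV := first_variation hab alpha_cont alpha_gt0 mf mq qK fuq.
have K1 : 1 <= K by rewrite /K; have := M0; lra.
(* Constants leave the derivative unchanged, so the directions [1] and [-1] both have rate [0], and
   the integral of [q] has both signs. *)
have Ga : G a = 0.
  apply/eqP; rewrite eq_le; apply/andP; split.
    have := FV (fun=> 1) 0 (measurable_cst _) _ hu _.
    under eq_Rintegral do rewrite mulr1.
    apply; first by move=> x _; rewrite normr1.
    move=> t _; exists m1, m2; split; last by rewrite mulr0 addr0.
    exact: derivative_pair_add_cst.
  have := FV (fun=> -1) 0 (measurable_cst _) _ hu _.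
  under eq_Rintegral do rewrite mulrC.
  rewrite RintegralZl// mulN1r oppr_le0; apply.
    by move=> x _; rewrite normrN normr1.
  move=> t _; exists m1, m2; split; last by rewrite mulr0 addr0.
  exact: derivative_pair_add_cst.
have Gb : G b = 0.
  by rewrite /G /tail_integral set_itv_ge ?bnd_simp ?ltxx// Rintegral_set0.
(* [G s] is the first variation of the fidelity term, up to sign, in the direction of the Heaviside
   function at [s]. *)
have Gdirac s : s \in `]a, b[ ->
    \int[mu]_(x in D) (q x * cdf_from a \d_s x) = G s.
  move=> sD; have [_ iG ->] := Fubini_cdf (\d_s) intq.
  rewrite Rintegral_dirac//; apply/measurable_EFinP.
  exact: measurable_int iG.
have cdfK s x : D x -> `|cdf_from a \d_s x| <= K.
  move=> _; rewrite ger0_norm ?cdf_from_ge0//.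
  apply: le_trans (cdf_from_le _ _ _) _.
  have E : \d_s [set: R] = 1%E :> \bar R by rewrite diracT.
  apply: le_trans K1; rewrite le_eqVlt; apply/orP; left; apply/eqP.
  exact: (congr1 fine E).
(* A jump of height [t] at [s] adds [t] times a Dirac mass to [m1], hence at most [t * alpha s] to
   the weighted variation; a downward jump, next, adds it to [m2]. *)
have Gle s : a < s < b -> G s <= alpha s.
  move=> sab; have sD : s \in `]a, b[ by rewrite in_itv.
  rewrite -Gdirac//; apply: FV => //; first exact: measurable_cdf_from.
    by move=> x Dx; exact: cdfK.
  move=> t /andP[t0 _]; pose tn := NngNum (ltW t0).
  exists (measure_add m1 (mscale tn \d_s)), m2; split.
    exact: (@derivative_pair_add_cdf _ _ _ _ _ _ _ tn intu
      (carried_dirac sD) u_pair).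
  rewrite weighted_mass_add// weighted_mass_scale// weighted_mass_dirac//=.
  by rewrite -/m1 -/m2; lra.
have Gge s : a < s < b -> - G s <= alpha s.
  move=> sab; have sD : s \in `]a, b[ by rewrite in_itv.
  have := FV (fun x => - cdf_from a \d_s x) (alpha s) _ _ hu _.
  have -> : (fun x => q x * - cdf_from a \d_s x) =
            (fun x => -1 * (q x * cdf_from a \d_s x)).
    by apply/funext => x; ring.
  have [iqc _ _] := Fubini_cdf (\d_s) intq.
  rewrite RintegralZl// Gdirac// mulN1r; apply.
  - by apply: measurableT_comp => //; exact: measurable_cdf_from.
  - by move=> x Dx; rewrite normrN cdfK.
  move=> t /andP[t0 _]; pose tn := NngNum (ltW t0).
  exists m1, (measure_add m2 (mscale tn \d_s)); split.
    exact: (@derivative_pair_sub_cdf _ _ _ _ _ _ _ tn intu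
      (carried_dirac sD) u_pair).
  rewrite weighted_mass_add// weighted_mass_scale// weighted_mass_dirac//=.
  by rewrite -/m1 -/m2; lra.
have [iqc1 iG1 F1] := Fubini_cdf m1 intq.
have [iqc2 iG2 F2] := Fubini_cdf m2 intq.
(* The direction [- v] contracts the derivative by [1 - t], so the variation falls at the rate [T0].
   By Fubini the integral of [q * v] is the right-hand side, the constant [C] contributing
   [C * G a = 0]. *)
have Gmass : weighted_mass a b alpha m1 + weighted_mass a b alpha m2 <=
    \int[m1]_(x in D) G x - \int[m2]_(x in D) G x.
  pose T0 := weighted_mass a b alpha m1 + weighted_mass a b alpha m2.
  have iCq : mu.-integrable D (EFin \o (fun x => C * q x)).
    exact: (integrableZl _ C intq).
  have iqq : mu.-integrable D
      (EFin \o (fun x => q x * cdf_from a m1 x - q x * cdf_from a m2 x)).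
    exact: (integrableB _ iqc1 iqc2).
  have iqv : mu.-integrable D (EFin \o (fun x => q x * v x)).
    apply: (@bounded_integrable_itv _ _ _ hab _ (K * K)).
      exact: measurable_funM.
    by move=> x Dx; rewrite normrM ler_pM// ?qK ?vK.
  have E : \int[mu]_(x in D) (q x * v x) =
      \int[m1]_(x in D) G x - \int[m2]_(x in D) G x.
    have -> : (fun x => q x * v x) = (fun x => C * q x +
      (q x * cdf_from a m1 x - q x * cdf_from a m2 x)).
      by apply/funext => x; rewrite /v; ring.
    rewrite RintegralD// RintegralZl// [X in _ + X]RintegralB// F1 F2.
    by rewrite -[X in C * X]/(G a) Ga mulr0 add0r.
  have := FV (fun x => - v x) (- T0) _ _ hu _.
  have -> : (fun x => q x * - v x) = (fun x => -1 * (q x * v x)).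
    by apply/funext => x; ring.
  rewrite RintegralZl// mulN1r lerN2 E; apply.
  - exact: measurableT_comp.
  - by move=> x Dx; rewrite normrN vK.
  move=> t /andP[t0 t1]; have t1' : 0 <= 1 - t by rewrite subr_ge0.
  pose tn := NngNum t1'.
  exists (mscale tn m1), (mscale tn m2); split.
    exact: (@derivative_pair_scale _ _ _ _ _ _ _ tn).
  rewrite !weighted_mass_scale// -/m1 -/m2 /= /T0.
  lra.
have ia1 := integrable_alpha hab alpha_cont alpha_gt0 m1.
have ia2 := integrable_alpha hab alpha_cont alpha_gt0 m2.
have iaG1 : m1.-integrable D (EFin \o (fun x => alpha x - G x)).
  exact: (integrableB _ ia1 iG1).
have iaG2 : m2.-integrable D (EFin \o (fun x => alpha x + G x)).
  exact: (integrableD _ ia2 iG2).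
have P1 x : D x -> 0 <= alpha x - G x.
  by move=> Dx; rewrite subr_ge0 Gle//.
have P2 x : D x -> 0 <= alpha x + G x.
  by move=> Dx; rewrite addrC -[G x]opprK addrC subr_ge0 Gge//.
have I1 : 0 <= \int[m1]_(x in D) (alpha x - G x) by exact: Rintegral_ge0.
have I2 : 0 <= \int[m2]_(x in D) (alpha x + G x) by exact: Rintegral_ge0.
(* Two nonnegative integrals with nonpositive sum both vanish, which confines [m1] and [m2] to the
   contact sets up to null sets. *)
have I12 : \int[m1]_(x in D) (alpha x - G x) +
           \int[m2]_(x in D) (alpha x + G x) <= 0.
  rewrite RintegralB// RintegralD//; move: Gmass; rewrite /weighted_mass.
  lra.
have [N1 [mN1 N10 sN1]] : exists N, [/\ measurable N, m1 N = 0%E &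
    forall x, D x -> alpha x - G x != 0 -> N x].
  by apply: Rintegral_eq0_ge0 => //; lra.
have [N2 [mN2 N20 sN2]] : exists N, [/\ measurable N, m2 N = 0%E &
    forall x, D x -> alpha x + G x != 0 -> N x].
  by apply: Rintegral_eq0_ge0 => //; lra.
have null (m : {finite_measure set R -> \bar R}) (N A : set R) :
    measurable N -> measurable A -> m N = 0%E -> A `<=` N -> m A = 0%E.
  move=> mN mA N0 AN; apply/eqP; rewrite eq_le measure_ge0 andbT -N0.
  by apply: le_measure; rewrite ?inE.
have cdfE (m : {finite_measure set R -> \bar R}) x y : a < x -> x <= y ->
    m `]x, y]%classic = 0%E -> cdf_from a m y = cdf_from a m x.
  move=> ax xy mxy; rewrite /cdf_from; congr fine.
  have -> : `]a, y]%classic = `]a, x]%classic `|` `]x, y]%classic.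
    by rewrite -itv_bndbnd_setU ?bnd_simp// ltW.
  rewrite measureU//.
    change ((m `]a, x]%classic + m `]x, y]%classic)%E = m `]a, x]%classic).
    by rewrite mxy adde0.
  apply/seteqP; split=> // z /=; rewrite !in_itv/= => -[/andP[_ zx] /andP[xz _]].
  by move: (lt_le_trans xz zx); rewrite ltxx.
have intqxy x y : a <= x -> y <= b -> mu.-integrable `]x, y[ (EFin \o q).
  move=> ax yb; apply: integrableS intq => //.
  by apply: subset_itv; rewrite bnd_simp.
exists v, G, K0; split=> //.
(* [G y - G x] is minus the integral of [q = ft - v] over []x, y[]. *)
- split=> x y k ax xy yb vk.
    rewrite -opprB (tailB intq)// -[leRHS]opprK lerN2 -mulNr.
    apply: Rintegral_ge_cst => //; first exact: intqxy.
    move=> z xzy; have /andP[h _] := ftM z; have := vk z xzy.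
    by rewrite /q; lra.
  rewrite -[leRHS]opprB (tailB intq)// -[leLHS]opprK lerN2 -mulNr.
  apply: Rintegral_le_cst => //; first exact: intqxy.
  move=> z xzy; have /andP[_ h] := ftM z; have := vk z xzy.
  by rewrite /q; lra.
split.
(* Without contact with [- alpha] the set []x, y]] is null for [m2], so the increment of [v] is that
   of the distribution function of [m1]. *)
- move=> x y ax xy yb noc.
  have E : cdf_from a m2 y = cdf_from a m2 x.
    apply: cdfE => //; apply: null mN2 _ N20 _ => // z /=.
    rewrite in_itv/= => /andP[xz zy]; apply: sN2.
      by rewrite /= in_itv/= (lt_trans ax)//= (le_lt_trans zy).
    by rewrite addrC addr_eq0 noc// xz.
  have := cdf_from_homo a m1 xy; rewrite /v E; lra.
- move=> x y ax xy yb noc.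
  have E : cdf_from a m1 y = cdf_from a m1 x.
    apply: cdfE => //; apply: null mN1 _ N10 _ => // z /=.
    rewrite in_itv/= => /andP[xz zy]; apply: sN1.
      by rewrite /= in_itv/= (lt_trans ax)//= (le_lt_trans zy).
    by rewrite subr_eq0 eq_sym noc// xz.
  have := cdf_from_homo a m2 xy; rewrite /v E; lra.
- move=> A mA AD noc.
  have A1 : m1 A = 0%E.
    apply: null mN1 mA N10 _ => z Az; apply: sN1; first exact: AD.
    by rewrite subr_eq0 eq_sym; exact: (noc z Az).1.
  have A2 : m2 A = 0%E.
    apply: null mN2 mA N20 _ => z Az; apply: sN2; first exact: AD.
    by rewrite addrC addr_eq0; exact: (noc z Az).2.
  change (m1 A + m2 A = 0)%E.
  by rewrite A1 A2 adde0.
Qed.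

End optimality.

Unset Implicit Arguments.
Set Printing Implicit Defensive.

Theorem proposition3p10 (R : realType) (a b : R) (hab : a < b)
    (f : R -> R) (hf : BV a b f)
    (alpha : R -> R)
    (alpha_cont : {within `[a, b], continuous alpha})
    (alpha_gt0 : forall x, x \in `[a, b] -> 0 < alpha x)
    (c d : R) (hcd : c < d) (hI : `]c, d[ `<=` `]a, b[)
    (alpha_diff : forall x, x \in `]c, d[ -> derivable alpha x 1)
    (alpha_steep : forall x, x \in `]c, d[ ->
      (2%:E * norm_Linfty a b f < `|derive1 alpha x|%:E)%E)
    (u : R -> R) (hu : weighted_TV_solution a b alpha f u) :
  constant_in a b u `]c, d[.
Proof.
(* The norm is an extended real; steepness at one point of the interval already forces it to be
   finite. *)
have mid : (c + d) / 2 \in `]c, d[ by rewrite in_itv/=; apply/andP; split; lra.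
have Nfin : (norm_Linfty a b f < +oo)%E.
  rewrite ltey; apply/negP => /eqP Ny.
  by have := alpha_steep _ mid; rewrite Ny gt0_muley ?lte_fin// ltNge leey.
have [M [M0 NM fM]] := norm_Linfty_ae hab Nfin.
have mf : measurable_fun `]a, b[%classic f.
  by apply/measurable_EFinP; case: hf => /measurable_int.
have [v [G [K [[K0 vK] [Gle Gge] [Ga Gb] [Ga1 Ga2] [vnd vni vac]]]]] :=
  solution_optimality hab alpha_cont alpha_gt0 mf M0 fM hu.
have a0 x : a < x < b -> 0 < alpha x.
  by move=> xab; apply: alpha_gt0; apply: subset_itv_oo_cc; rewrite in_itv.
have steep x : x \in `]c, d[ -> 2 * M < `|derive1 alpha x|.
  by move=> /alpha_steep; rewrite NM -EFinM lte_fin.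
apply: vac => // z zcd.
have zab : a < z < b by have := hI _ zcd; rewrite /= in_itv.
have dz : derivable alpha z 1 by exact: alpha_diff.
have sz : 2 * M < `|derive1 alpha z| by exact: steep.
split; first exact: (no_contact K0 M0 vK Gle Gge Ga Gb Ga1 a0 vnd zab dz sz).
(* Replacing [G] and [v] by their opposites turns contact with [- alpha] into contact with [alpha];
   the two slope bounds are exchanged, and [vni] takes the place of [vnd]. *)
rewrite -eqr_oppLR.
apply: (@no_contact _ a b M K (fun x => - G x) (fun x => - v x) alpha) => //.
- by move=> x; rewrite normrN.
- move=> x y k ax xy yb vk; rewrite -opprD -[leRHS]opprK lerN2 -mulNr opprD.
  by apply: Gge => // w xw; rewrite lerNl vk.
- move=> x y k ax xy yb vk.
  rewrite -opprD -[leLHS]opprK lerN2 -mulNr opprB [M - k]addrC.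
  by apply: Gle => // w xw; rewrite lerNr vk.
- by rewrite Ga oppr0.
- by rewrite Gb oppr0.
- move=> x y ax xy yb noc; rewrite lerN2; apply: vni => // w xw.
  by have := noc w xw; rewrite eqr_opp.
Qed.
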